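(* Let $\alpha>0$ and $\beta,\gamma\in\mathbb{R}$, and let $m\in\mathbb{N}$ be such that $m-1<\alpha\le m$. Let $f$ be a real-valued function that is $m-1$ times continuously differentiable on $[0,\infty)$ and $m$ times continuously differentiable on $(0,\infty)$, such that $f^{(m)}(t)=O(t^\epsilon)$ as $t\to0^+$ for some real $\epsilon$ with $\epsilon>\max\{0,-\beta-m-\alpha-\gamma\}-1$ and $\epsilon+\beta+m>\max\{0,\beta-\gamma\}-1$. Then, for $t>0$, $$I_t^{\alpha,\beta,\gamma}\,\partial_t^{\alpha,\beta,\gamma}f(t)=f(t)-\sum_{k=0}^{m-1}\frac{f^{(k)}(0)}{k!}\,t^k .$$
   Context: Saigo fractional integral: for real $a>0$, $b$, $c$ and a continuous real-valued function $g$ on $(0,\infty)$ with $g(t)=O(t^\epsilon)$ as $t\to 0^+$ for some $\epsilon>\max\{0,b-c\}-1$, $$I_t^{a,b,c}g(t)=\frac{t^{-a-b}}{\Gamma(a)}\int_0^t(t-s)^{a-1}\,{}_2F_1\!\left(a+b,-c;a;1-\frac{s}{t}\right)g(s)\,ds,$$ where ${}_2F_1(p,q;r;z)=\sum_{k=0}^\infty\frac{(p)^{\overline{k}}(q)^{\overline{k}}}{(r)^{\overline{k}}}\frac{z^k}{k!}$ for $|z|<1$ is the Gauss hypergeometric function and $(x)^{\overline{k}}=x(x+1)\cdots(x+k-1)$ is the rising factorial. For order zero, $I_t^{0,b,c}g(t)=\frac{d}{dt}I_t^{1,b-1,c-1}g(t)$. Caputo-type Saigo fractional derivative: for $\alpha>0$,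 $\beta,\gamma\in\mathbb{R}$ and $m-1<\alpha\le m$, $m\in\mathbb{N}$, $$\partial_t^{\alpha,\beta,\gamma}f(t)=I_t^{m-\alpha,\,-\beta-m,\,\alpha+\gamma}f^{(m)}(t),\qquad f^{(m)}(t)=\frac{d^m}{dt^m}f(t).$$ *)

(* Defs.v *)
From mathcomp Require Import all_boot all_order all_algebra.
From mathcomp Require Import all_classical all_reals all_analysis.

Set Implicit Arguments.
Unset Strict Implicit.
Unset Printing Implicit Defensive.

Import Order.TTheory GRing.Theory Num.Theory.
Import numFieldNormedType.Exports.

Local Open Scope classical_set_scope.
Local Open Scope ring_scope.

(* Euler's integral; meaningful for 0 < a, the only values used below. *)
Definition gamma_fun (R : realType) (a : R) : R :=
  \int[lebesgue_measure]_(x in `]0, +oo[) (x `^ (a - 1) * expR (- x)).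

Definition rising (R : realType) (x : R) (k : nat) : R :=
  \prod_(i < k) (x + i%:R).

(* Meaningful for |z| < 1 and r not in {0, -1, -2, ...}. *)
Definition hyp2F1 (R : realType) (p q r z : R) : R :=
  limn (series (fun k : nat =>
    rising p k * rising q k / rising r k * (z ^+ k / k`!%:R))).

(* Formula for positive order a.  The integral is a Lebesgue integral: under
   the growth condition on g at 0 it converges absolutely, although the
   integrand may be unbounded at both endpoints. *)
Definition saigo_pos (R : realType) (a b c : R) (g : R -> R) (t : R) : R :=
  t `^ (- a - b) / gamma_fun a *
  \int[lebesgue_measure]_(s in `]0, t[)
    ((t - s) `^ (a - 1) * hyp2F1 (a + b) (- c) a (1 - s / t) * g s).

(* Order a >= 0; only t > 0 is meaningful, and only the values of g on
   ]0, +oo[ matter. *)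
Definition saigo (R : realType) (a b c : R) (g : R -> R) (t : R) : R :=
  if a == 0 then derive1 (saigo_pos 1 (b - 1) (c - 1) g) t
  else saigo_pos a b c g t.

(* Caputo-type derivative, for m - 1 < alpha <= m. *)
Definition saigo_caputo (R : realType) (m : nat) (alpha beta gamma : R)
    (f : R -> R) : R -> R :=
  saigo (m%:R - alpha) (- beta - m%:R) (alpha + gamma) (derive1n m f).

(* Derivatives relative to A: the increment is restricted to A, so that on
   A = [0, +oo[ the derivative at 0 is one-sided, while at x > 0 it is the
   usual one.  The values of f outside A play no role at points of A. *)
Definition diff_quot (R : realType) (f : R -> R) (x y : R) : R :=
  (f y - f x) / (y - x).

Definition derivable_within (R : realType) (A : set R) (f : R -> R) (x : R) :=
  cvg (diff_quot f x @ within A x^').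

Definition derive1_within (R : realType) (A : set R) (f : R -> R) (x : R) : R :=
  lim (diff_quot f x @ within A x^').

Definition derive1n_within (R : realType) (A : set R) (n : nat) (f : R -> R) :
  R -> R := iter n (derive1_within A) f.

Definition cont_diff_within (R : realType) (A : set R) (n : nat) (f : R -> R) :=
  (forall (k : nat) (x : R), (k < n)%N -> A x ->
     derivable_within A (derive1n_within A k f) x) /\
  {within A, continuous (derive1n_within A n f)}.

Definition cont_diff_pos (R : realType) (n : nat) (f : R -> R) :=
  (forall (k : nat) (x : R), (k < n)%N -> 0 < x ->
     derivable (derive1n k f) x 1) /\
  (forall x : R, 0 < x -> {for x, continuous (derive1n n f)}).

(* Main.v *)
From HB Require Import structures.
Require Import Defs.
From mathcomp Require Import all_boot all_order all_algebra.
From mathcomp Require Import all_classical all_reals all_analysis.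
From mathcomp Require Import measurable_realfun ring lra zify.

(** Write I for the Saigo integral of order alpha and D for the Caputo type
    derivative. With g = f^(m), the composition I D f is I J g, where J is another
    Saigo operator, of order m - alpha. The claim is that I J is the m-fold
    Riemann-Liouville integral; Taylor's formula with integral remainder
    ([taylor_remainder]) then finishes the proof.

    After the substitution s = t x, each of the three operators has the form
    t^d * (k0 g(t) + \int_0^1 k(x) g(t x) dx) ([mellin_op]), with k0 = 0 unless the
    order is zero. Such an operator multiplies t^p by t^d times a constant, its
    multiplier, given by a moment of k. It is continuous for the norms
    sup |g(s)| s^(-e) over ]0, t] ([mellin_op_lipschitz]), provided that k is
    integrable against x^e. The hypotheses on eps are open conditions, so they
    still hold for some e < eps; then g(s) s^(-e) extends continuously to [0, t],
    and by Weierstrass's theorem g is a limit of sums of the powers s^(e+i) in that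
    norm ([growth_power_approx]). Hence two continuous operators agree on g as soon
    as their multipliers agree ([growth_density]).

    Termwise integration of the hypergeometric kernel shows that the multiplier of
    a Saigo operator is a Beta integral times a Gauss series at argument 1
    ([saigo_kernel_moment]). Its value as a quotient of Gamma functions is replaced
    by two facts: a recursion relating p and p + 1, obtained by telescoping the
    series ([gauss_sum_rec], [saigo_mult_rec]), and the behaviour n^(-a) along
    p + n ([saigo_mult_cvg1]). The product of the multipliers of I and J, times
    (p+1) ... (p+m), is therefore 1-periodic with limit 1 along p + n, hence equal
    to 1 ([saigo_mult_compose]); and 1 / ((p+1) ... (p+m)) is the multiplier of the
    m-fold integral.

    For alpha = m the operator J has order zero and is defined as a derivative. The
    same density argument shows that the function being differentiated is the
    integral of an operator of the above form, whose atom k0 = 1 comes from the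
    constant term of the Gauss series ([saigo_primitive]). *)

Set Implicit Arguments.
Unset Strict Implicit.
Unset Printing Implicit Defensive.

Import Order.TTheory GRing.Theory Num.Theory.
Import numFieldNormedType.Exports.

Local Open Scope classical_set_scope.
Local Open Scope ring_scope.

(** * Affine change of variables *)

Notation mu := (@lebesgue_measure _).

Lemma measurable_affine (R : realType) (c d : R) :
  measurable_fun [set: R] (fun x : R => c * x + d).
Proof. exact: measurable_funD. Qed.

Lemma preimage_affine_itv (R : realType) (c d : R) (b0 b1 : bool) (u v : R) :
  0 < c -> (fun x : R => c * x + d) @^-1` [set` Interval (BSide b0 u) (BSide b1 v)]
  = [set` Interval (BSide b0 ((u - d) / c)) (BSide b1 ((v - d) / c))].
Proof.
move=> c0; apply/seteqP; split=> x /=; rewrite !in_itv /=.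
  by case: b0; case: b1; rewrite /= ?ler_pdivrMr ?ltr_pdivrMr ?ler_pdivlMr ?ltr_pdivlMr //;
    move=> /andP[? ?]; apply/andP; split; lra.
by case: b0; case: b1; rewrite /= ?ler_pdivrMr ?ltr_pdivrMr ?ler_pdivlMr ?ltr_pdivlMr //;
    move=> /andP[? ?]; apply/andP; split; lra.
Qed.

Lemma preimage_affine_itvN (R : realType) (c d : R) (b0 b1 : bool) (u v : R) :
  c < 0 -> (fun x : R => c * x + d) @^-1` [set` Interval (BSide b0 u) (BSide b1 v)]
  = [set` Interval (BSide (~~ b1) ((v - d) / c)) (BSide (~~ b0) ((u - d) / c))].
Proof.
move=> c0; apply/seteqP; split=> x /=; rewrite !in_itv /=.
  by case: b0; case: b1; rewrite /= ?ler_ndivrMr ?ltr_ndivrMr ?ler_ndivlMr ?ltr_ndivlMr //;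
    move=> /andP[? ?]; apply/andP; split; lra.
by case: b0; case: b1; rewrite /= ?ler_ndivrMr ?ltr_ndivrMr ?ler_ndivlMr ?ltr_ndivlMr //;
    move=> /andP[? ?]; apply/andP; split; lra.
Qed.

Lemma measurable_affine_lebesgue (R : realType) (c d : R) :
  @measurable_fun _ _ (measurableTypeR R) (measurableTypeR R) setT
    (fun x : R => c * x + d).
Proof. exact: measurable_affine. Qed.

Definition affine_pushforward (R : realType) (c d : R) :
    {measure set (measurableTypeR R) -> \bar R} :=
  measure_function_pushforward__canonical__measure_function_Measure
    (@lebesgue_measure R) (measurable_affine_lebesgue c d).

(** Lebesgue measure is the only measure giving every half-open interval its
    length, and |c| times the pushforward along x |-> c x + d does so. *)
Lemma lebesgue_measure_affine (R : realType) (c d : R) (A : set R) : c != 0 ->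
  measurable A ->
  lebesgue_measure A =
  mscale (NngNum (normr_ge0 c)) (affine_pushforward c d) A.
Proof.
move=> c0 mA.
apply: (@lebesgue_measure_unique R (mscale (NngNum (normr_ge0 c))
  (affine_pushforward c d))) => // _ [[u v] _ <-] /=.
rewrite /mscale /= /pushforward /=.
have [c1|c1|c1] := ltgtP c 0; last by rewrite c1 eqxx in c0.
  rewrite preimage_affine_itvN // !lebesgue_measure_itv /= !lte_fin.
  rewrite ltr_nM2r ?invr_lt0 // ltrD2r.
  case: ifPn => _; last by rewrite mule0.
  rewrite -!EFinB -EFinM ltr0_norm //; congr EFin.
  by field.
rewrite preimage_affine_itv // !lebesgue_measure_itv /= !lte_fin.
rewrite ltr_pM2r ?invr_gt0 // ltrD2r.
case: ifPn => _; last by rewrite mule0.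
rewrite -!EFinB -EFinM gtr0_norm //; congr EFin.
by field.
Qed.

Lemma ge0_integral_affine (R : realType) (c d : R) (D : set R)
    (f : R -> \bar R) : measurable D -> c != 0 -> measurable_fun D f ->
  (forall x, D x -> (0 <= f x)%E) ->
  (\int[mu]_(y in D) f y =
   `|c|%:E * \int[mu]_(x in (fun x : R => c * x + d)%R @^-1` D) f (c * x + d)%R)%E.
Proof.
move=> mD c0 mf f0.
transitivity (\int[mscale (NngNum (normr_ge0 c)) (affine_pushforward c d)]_(y in D)
    f y)%E.
  by apply: eq_measure_integral => A mA _; exact: lebesgue_measure_affine.
rewrite ge0_integral_mscale //=; congr (_ * _)%E.
rewrite (ge0_integral_pushforward (measurable_affine_lebesgue c d)) //.
by move=> y /set_mem; exact: f0.
Qed.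

Lemma measurable_fun_affine (R : realType) (c d : R) (D : set R) (f : R -> R) :
  measurable D -> measurable_fun D f ->
  measurable_fun ((fun x : R => c * x + d) @^-1` D) (fun x => f (c * x + d)).
Proof.
move=> mD mf; apply: (measurable_comp mD) => //.
  by move=> _ [x Dx <-].
exact: measurable_funTS (measurable_affine c d).
Qed.

(** Positive and negative parts both scale by |c|; if one of their integrals is
    infinite, the real-valued integrals on both sides are 0. *)
Lemma Rintegral_affine (R : realType) (c d : R) (D : set R) (f : R -> R) :
  measurable D -> c != 0 -> measurable_fun D f ->
  \int[mu]_(y in D) f y =
  `|c| * \int[mu]_(x in (fun x : R => c * x + d) @^-1` D) f (c * x + d).
Proof.
move=> mD c0 mf; rewrite /Rintegral integralE [in RHS]integralE.
have mf' : measurable_fun D (EFin \o f) by exact/measurable_EFinP.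
have fp : (forall x, D x -> 0 <= (EFin \o f)^\+ x)%E by [].
have fn : (forall x, D x -> 0 <= (EFin \o f)^\- x)%E by [].
have := ge0_integral_affine d mD c0 (measurable_funepos mf') fp.
have := ge0_integral_affine d mD c0 (measurable_funeneg mf') fn.
move=> -> ->.
set a := (\int[_]_(x in _) _)%E.
set b := (\int[_]_(x in _) _)%E.
have k0 : 0 < `|c| by rewrite normr_gt0.
have a0 : (0 <= a)%E by exact: integral_ge0.
have b0 : (0 <= b)%E by exact: integral_ge0.
transitivity (`|c| * fine (a - b)); last first.
  by congr (_ * fine (_ - _)%E); apply: eq_integral => x _;
    rewrite ?funeposE ?funenegE.
have ky : (`|c|%:E * +oo = +oo)%E by rewrite gt0_muley ?lte_fin.
case: a b a0 b0 => [r||] [r'||] //= _ _; rewrite ?ky ?mulr0 //=.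
by rewrite mulrBr.
Qed.

Lemma integrable_affine (R : realType) (c d : R) (D : set R) (f : R -> R) :
  measurable D -> c != 0 -> measurable_fun D f ->
  mu.-integrable D (EFin \o f) <->
  mu.-integrable ((fun x : R => c * x + d) @^-1` D)
    (EFin \o (fun x => f (c * x + d))).
Proof.
move=> mD c0 mf.
have k0 : 0 < `|c| by rewrite normr_gt0.
have mf' : measurable_fun D (EFin \o f) by exact/measurable_EFinP.
have mg : measurable_fun ((fun x : R => c * x + d) @^-1` D)
    (EFin \o (fun x => f (c * x + d))).
  by apply/measurable_EFinP; exact: measurable_fun_affine.
have E : (\int[mu]_(x in D) `|(EFin \o f) x| =
  `|c|%:E * \int[mu]_(x in (fun x : R => c * x + d)%R @^-1` D)
    `|(EFin \o (fun x => f (c * x + d)%R)) x|)%E.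
  rewrite (@ge0_integral_affine _ c d) //.
  exact: measurableT_comp.
have i0 : (0 <= \int[mu]_(x in (fun x : R => c * x + d)%R @^-1` D)
    `|(EFin \o (fun x => f (c * x + d)%R)) x|)%E by exact: integral_ge0.
split => /integrableP[_ h]; apply/integrableP; split => //; move: h; rewrite E.
  move: i0; case: (integral _ _ _) => [r||] // _; rewrite ?ltry//.
  by rewrite gt0_muley ?lte_fin // ltxx.
move: i0; case: (integral _ _ _) => [r||] // _ _; by rewrite -EFinM ltry.
Qed.

(** * The fundamental theorem of calculus on open intervals *)

Lemma oo_exhaustion (R : realType) (a b : R) : a < b ->
  exists u v : R^nat,
    [/\ (forall n, a < u n /\ u n < v n /\ v n < b),
        u @ \oo --> a, v @ \oo --> b,
        {homo (fun n => `[u n, v n]%classic) : n m / (n <= m)%N >-> (n <= m)%O} &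
        \bigcup_n `[u n, v n]%classic = `]a, b[%classic].
Proof.
move=> ab.
(* The 3 makes the segment of index 0 nonempty: h 0 = (b - a) / 3. *)
pose h n : R := (b - a) * (3 + n%:R)^-1.
have h_gt0 n : 0 < h n.
  by rewrite mulr_gt0 ?subr_gt0 ?invr_gt0 // ltr_wpDr.
have hl n : h n * 3 <= b - a.
  rewrite /h mulrAC ler_pdivrMr ?ltr_wpDr// ler_pM2l ?subr_gt0//.
  by rewrite lerDl.
have hmono n m : (n <= m)%N -> h m <= h n.
  move=> nm; rewrite ler_pM2l ?subr_gt0// lef_pV2 ?posrE ?ltr_wpDr//.
  by rewrite lerD2l ler_nat.
have hcvg : h @ \oo --> (0 : R).
  rewrite -(mulr0 (b - a)); apply: cvgMr.
  apply/gtr0_cvgV0.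
    by apply: nearW => n; rewrite ltr_wpDr.
  apply/cvgryPge => A; near=> n.
  have : A <= n%:R by near: n; exact: nbhs_infty_ger.
  lra.
exists (fun n => a + h n), (fun n => b - h n); split.
- move=> n; have := h_gt0 n; have := hl n; lra.
- by rewrite -[X in _ --> X]addr0; apply: cvgD => //; exact: cvg_cst.
- by rewrite -[X in _ --> X]subr0; apply: cvgB => //; exact: cvg_cst.
- move=> n m nm; rewrite subsetEset => x /=; rewrite !in_itv/=.
  by have := hmono _ _ nm => ? /andP[? ?]; apply/andP; split; lra.
- apply/seteqP; split => x /=.
    move=> [n _] /=; rewrite !in_itv/= => /andP[? ?].
    by have := h_gt0 n; have := hl n => ? ?; apply/andP; split; lra.
  rewrite in_itv/= => /andP[ax xb].
  have [n [hn1 hn2]] : exists n, h n <= x - a /\ h n <= b - x.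
    have p1 : \forall n \near \oo, h n <= x - a.
      by apply: (cvgr_le _ hcvg); rewrite subr_gt0.
    have p2 : \forall n \near \oo, h n <= b - x.
      by apply: (cvgr_le _ hcvg); rewrite subr_gt0.
    near \oo => n; exists n; split.
      by near: n; exact: p1.
    by near: n; exact: p2.
  by exists n => //=; rewrite in_itv/=; apply/andP; split; lra.
Unshelve. all: by end_near. Qed.

Lemma open_measurable_fun (R : realType) (f : R -> R) (D : set R) :
  open D ->
  (forall x, D x -> {for x, continuous f}) -> measurable_fun D f.
Proof.
by move=> oD cf; apply: open_continuous_measurable_fun => // x /set_mem; exact: cf.
Qed.

Lemma itv_oo_measurable_fun (R : realType) (f : R -> R) (a b : R) :
  (forall x, a < x -> x < b -> {for x, continuous f}) ->
  measurable_fun `]a, b[ f.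
Proof.
move=> cf; apply: open_measurable_fun => // x /=.
by rewrite in_itv/= => /andP[]; exact: cf.
Qed.

Lemma FTC_subsegment (R : realType) (F f : R -> R) (a b u v : R) :
  (forall x, a < x -> x < b -> {for x, continuous f}) ->
  (forall x, a < x -> x < b -> is_derive x 1 F (f x)) ->
  a < u -> u < v -> v < b ->
  (\int[mu]_(x in `[u, v]) (f x)%:E = (F v - F u)%:E)%E.
Proof.
move=> cf dF au uv vb.
have cF x : a < x -> x < b -> F @ x --> F x.
  move=> ax xb; apply: differentiable_continuous; apply/derivable1_diffP.
  by have := dF _ ax xb => dd; exact: ex_derive.
rewrite EFinB; apply: continuous_FTC2 => //.
- apply: continuous_in_subspaceT => x /set_mem /=; rewrite in_itv/= => /andP[ux xv].
  by apply: cf; [exact: lt_le_trans ux|exact: le_lt_trans vb].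
- split.
  + move=> x; rewrite in_itv/= => /andP[ux xv].
    have := dF x (lt_trans au ux) (lt_trans xv vb) => dd; exact: ex_derive.
  + by apply: cvg_at_right_filter; apply: cF => //; exact: lt_trans vb.
  + by apply: cvg_at_left_filter; apply: cF => //; exact: lt_trans uv.
- move=> x; rewrite in_itv/= => /andP[ux xv].
  have := dF x (lt_trans au ux) (lt_trans xv vb) => dd.
  by rewrite derive1E derive_val.
Qed.

(** An integrable singularity at an endpoint is allowed: the theorem on segments
    applies to an exhaustion of the open interval, and monotone convergence
    passes to the limit. *)
Lemma ge0_FTC_oo (R : realType) (F f : R -> R) (a b : R) : a < b ->
  (forall x, a < x -> x < b -> 0 <= f x) ->
  (forall x, a < x -> x < b -> {for x, continuous f}) ->
  (forall x, a < x -> x < b -> is_derive x 1 F (f x)) ->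
  F x @[x --> a^'+] --> F a -> F x @[x --> b^'-] --> F b ->
  (\int[mu]_(x in `]a, b[) (f x)%:E = (F b - F a)%:E)%E.
Proof.
move=> ab f0 cf dF Fa Fb.
have [u [v [uv ua vb ndE EE]]] := oo_exhaustion ab.
have uvab n x : u n <= x <= v n -> a < x /\ x < b.
  by move=> /andP[? ?]; have [? [? ?]] := uv n; split; lra.
have mf : measurable_fun `]a, b[ f by exact: itv_oo_measurable_fun.
have : (\int[mu]_(x in `[u i, v i]) (f x)%:E)%E @[i --> \oo] -->
       (\int[mu]_(x in \bigcup_i `[u i, v i]%classic) (f x)%:E)%E.
  apply: ge0_nondecreasing_set_cvg_integral.
  - exact: ndE.
  - by move=> i; exact: measurable_itv.
  - move=> i; apply/measurable_EFinP; apply: measurable_funS mf => //.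
    by move=> x /=; rewrite !in_itv/= => /uvab[-> ->].
  - move=> i x /=; rewrite in_itv /= => /uvab[? ?]; rewrite lee_fin; exact: f0.
rewrite EE => h1.
have h2 : (\int[mu]_(x in `[u i, v i]) (f x)%:E)%E @[i --> \oo] --> (F b - F a)%:E.
  under eq_fun => i.
    have [? [? ?]] := uv i.
    rewrite (FTC_subsegment cf dF) //. over.
  apply: cvg_EFin; first exact: nearW.
  apply: cvgB.
    by apply: (cvg_at_leftP _ _ _).1 Fb _ _; split => // n; have [? [? ?]] := uv n.
  by apply: (cvg_at_rightP _ _ _).1 Fa _ _; split => // n; have [? [? ?]] := uv n.
by have /cvg_lim <- // := h1; apply: cvg_lim.
Qed.

Lemma ge0_FTC_oo_integrable (R : realType) (F f : R -> R) (a b : R) : a < b ->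
  (forall x, a < x -> x < b -> 0 <= f x) ->
  (forall x, a < x -> x < b -> {for x, continuous f}) ->
  (forall x, a < x -> x < b -> is_derive x 1 F (f x)) ->
  F x @[x --> a^'+] --> F a -> F x @[x --> b^'-] --> F b ->
  mu.-integrable `]a, b[ (EFin \o f).
Proof.
move=> ab f0 cf dF Fa Fb; apply/integrableP; split.
  by apply/measurable_EFinP; exact: itv_oo_measurable_fun.
have <- : (\int[mu]_(x in `]a, b[) (f x)%:E = \int[mu]_(x in `]a, b[) `|(EFin \o f) x|)%E.
  apply: eq_integral => x /set_mem /=; rewrite in_itv/= => /andP[ax xb].
  by rewrite ger0_norm // f0.
by rewrite (ge0_FTC_oo ab f0 cf dF Fa Fb) ltry.
Qed.

(** For f of variable sign the same exhaustion works by dominated convergence,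
    with |f| as dominating function. *)
Lemma Rintegral_FTC_oo (R : realType) (F f : R -> R) (a b : R) : a < b ->
  (forall x, a < x -> x < b -> {for x, continuous f}) ->
  (forall x, a < x -> x < b -> is_derive x 1 F (f x)) ->
  F x @[x --> a^'+] --> F a -> F x @[x --> b^'-] --> F b ->
  mu.-integrable `]a, b[ (EFin \o f) ->
  \int[mu]_(x in `]a, b[) f x = F b - F a.
Proof.
move=> ab cf dF Fa Fb intf.
have [u [v [uv ua vb ndE EE]]] := oo_exhaustion ab.
have uvab n x : u n <= x <= v n -> a < x /\ x < b.
  by move=> /andP[? ?]; have [? [? ?]] := uv n; split; lra.
have mf : measurable_fun `]a, b[ f by exact: itv_oo_measurable_fun.
pose g n : R -> \bar R := (EFin \o f) \_ `[u n, v n].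
have [] := @dominated_convergence _ _ R mu `]a, b[ (measurable_itv _) g (EFin \o f)
  (fun x => `|(EFin \o f) x|)%E.
- move=> n; apply/measurable_restrict => //; apply/measurable_EFinP.
  by apply: measurable_funS mf => // x /= [].
- exact/measurable_EFinP.
- apply: aeW => x /= xab; apply: cvg_near_cst.
  move: (xab); rewrite in_itv /= => /andP[ax xb].
  have p1 : \forall n \near \oo, u n <= x by apply: (cvgr_le _ ua).
  have p2 : \forall n \near \oo, x <= v n by apply: (cvgr_ge _ vb).
  near=> n; rewrite /g patchE ifT // inE /= in_itv /=.
  by apply/andP; split; near: n.
- exact: integrable_abse.
- apply: aeW => x n /= _; rewrite /g patchE; case: ifPn => // _.
  by rewrite /point /= normr0 lee_fin.
move=> _ _ h1.
have h2 : (\int[mu]_(x in `]a, b[) g n x)%E @[n --> \oo] --> (F b - F a)%:E.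
  have -> : (fun n => \int[mu]_(x in `]a, b[) g n x)%E = (fun n => (F (v n) - F (u n))%:E).
    apply/funext => n; have [? [? ?]] := uv n.
    rewrite /g -integral_mkcondr setIidr; first exact: FTC_subsegment cf dF _ _ _.
    by move=> x /=; rewrite !in_itv/= => /uvab[-> ->].
  apply: cvg_EFin; first exact: nearW.
  apply: cvgB.
    by apply: (cvg_at_leftP _ _ _).1 Fb _ _; split => // n; have [? [? ?]] := uv n.
  by apply: (cvg_at_rightP _ _ _).1 Fa _ _; split => // n; have [? [? ?]] := uv n.
rewrite /Rintegral.
have -> : (\int[mu]_(x in `]a, b[) (f x)%:E = (F b - F a)%:E)%E => //.
by rewrite -(cvg_lim _ h1) // -(cvg_lim _ h2).
Unshelve. all: by end_near. Qed.

(** * Powers and Beta integrals *)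

Lemma is_derive1_eq (R : realType) (f g : R -> R) (x df dg : R) :
  is_derive x 1 f df -> f =1 g -> df = dg -> is_derive x 1 g dg.
Proof. by move=> h /funext <- <-. Qed.

Lemma is_derive1_continuous (R : realType) (f : R -> R) (x df : R) :
  is_derive x 1 f df -> {for x, continuous f}.
Proof.
move=> dd; apply: differentiable_continuous; apply/derivable1_diffP.
exact: ex_derive.
Qed.

Lemma powR_continuous (R : realType) (p x : R) : 0 < x ->
  {for x, continuous (fun y : R => y `^ p)}.
Proof. by move=> x0; exact: is_derive1_continuous (is_derive1_powR p x0). Qed.

Lemma powR_cvg0_at (R : realType) (p : R) : 0 < p ->
  x `^ p @[x --> 0^'+] --> (0 : R) `^ p.
Proof. by move=> p0; rewrite powR0 ?gt_eqF//; exact: powR_cvg0. Qed.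

Lemma dominated_integrable (R : realType) (D : set R) (f g : R -> R) :
  measurable D -> measurable_fun D f ->
  (forall x, D x -> `|f x| <= g x) -> mu.-integrable D (EFin \o g) ->
  mu.-integrable D (EFin \o f).
Proof.
move=> mD mf fg; apply: le_integrable => //.
  exact/measurable_EFinP.
move=> x Dx /=; rewrite lee_fin.
by rewrite (le_trans (fg _ Dx))// ler_norm.
Qed.

Lemma integrable_add (R : realType) (D : set R) (f g : R -> R) :
  measurable D -> mu.-integrable D (EFin \o f) ->
  mu.-integrable D (EFin \o g) ->
  mu.-integrable D (EFin \o (fun x => f x + g x)).
Proof.
move=> mD fi gi.
by apply: eq_integrable (integrableD _ fi gi).
Qed.

Lemma integrable_scale (R : realType) (D : set R) (c : R) (f : R -> R) :
  measurable D -> mu.-integrable D (EFin \o f) ->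
  mu.-integrable D (EFin \o (fun x => c * f x)).
Proof.
move=> mD fi; by apply: eq_integrable (integrableZl _ c fi).
Qed.

Lemma Rintegral_scale (R : realType) (D : set R) (c : R) (f : R -> R) :
  measurable D -> mu.-integrable D (EFin \o f) ->
  \int[mu]_(x in D) (c * f x) = c * \int[mu]_(x in D) f x.
Proof. by move=> mD fi; exact: RintegralZl. Qed.

Lemma powR_antiderive (R : realType) (p x : R) : -1 < p -> 0 < x ->
  is_derive x 1 (fun y : R => y `^ (p + 1) / (p + 1)) (x `^ p).
Proof.
move=> p1 x0; have p10 : p + 1 != 0 by lra.
have := is_deriveM (is_derive1_powR (p + 1) x0) (is_derive_cst ((p + 1)^-1) x 1).
move=> h; apply: is_derive1_eq h _ _ => //.
by rewrite scaler0 add0r /GRing.scale /= addrK mulrA mulVf ?mul1r.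
Qed.

Lemma powR_antiderive_bounds (R : realType) (p t : R) : -1 < p -> 0 < t ->
  let F := fun y : R => y `^ (p + 1) / (p + 1) in
  F x @[x --> 0^'+] --> F 0 /\ F x @[x --> t^'-] --> F t.
Proof.
move=> p1 t0 F; split.
  by apply: cvgMl; apply: powR_cvg0_at; lra.
by apply: cvg_at_left_filter; exact: is_derive1_continuous (powR_antiderive p1 t0).
Qed.

Lemma integrable_powR (R : realType) (p t : R) : -1 < p -> 0 < t ->
  mu.-integrable `]0, t[ (EFin \o (fun x : R => x `^ p)).
Proof.
move=> p1 t0; have [F0 Ft] := powR_antiderive_bounds p1 t0.
apply: (@ge0_FTC_oo_integrable R _ _ 0 t) F0 Ft => //.
- by move=> *; exact: powR_ge0.
- by move=> x x0 _; exact: powR_continuous.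
- by move=> x x0 _; exact: powR_antiderive.
Qed.

Lemma Rintegral_powR (R : realType) (p t : R) : -1 < p -> 0 < t ->
  \int[mu]_(x in `]0, t[) (x `^ p) = t `^ (p + 1) / (p + 1).
Proof.
move=> p1 t0; have [F0 Ft] := powR_antiderive_bounds p1 t0.
have cf x : 0 < x -> x < t -> {for x, continuous (fun y : R => y `^ p)}.
  by move=> x0 _; exact: powR_continuous.
have dF x : 0 < x -> x < t ->
    is_derive x 1 (fun y : R => y `^ (p + 1) / (p + 1)) (x `^ p).
  by move=> x0 _; exact: powR_antiderive.
rewrite (Rintegral_FTC_oo t0 cf dF F0 Ft (integrable_powR p1 t0)).
by rewrite powR0 ?mul0r ?subr0//; lra.
Qed.

Lemma onem_preimage_oo (R : realType) :
  (fun x : R => -1 * x + 1) @^-1` `]0, 1[ = `](0 : R), 1[%classic.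
Proof. by apply/seteqP; split => x /=; rewrite !in_itv/= => /andP[? ?]; apply/andP; split; lra. Qed.

Lemma Rintegral_onem (R : realType) (f : R -> R) :
  measurable_fun `](0 : R), 1[ f ->
  \int[mu]_(x in `]0, 1[) f x = \int[mu]_(x in `]0, 1[) f (1 - x).
Proof.
move=> mf; rewrite (@Rintegral_affine R (-1) 1) ?onem_preimage_oo//.
by rewrite normrN1 mul1r; apply: eq_Rintegral => x _; rewrite mulN1r addrC.
Qed.

Lemma integrable_onem (R : realType) (f : R -> R) :
  measurable_fun `](0 : R), 1[ f ->
  mu.-integrable `]0, 1[ (EFin \o f) ->
  mu.-integrable `]0, 1[ (EFin \o (fun x => f (1 - x))).
Proof.
move=> mf; rewrite (@integrable_affine R (-1) 1) ?onem_preimage_oo//.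
have -> // : (fun x : R => f (-1 * x + 1)) = (fun x => f (1 - x)).
  by apply/funext => x; rewrite mulN1r addrC.
Qed.

Lemma measurable_powR_itv (R : realType) (D : set R) (p : R) :
  measurable_fun D (fun x : R => x `^ p).
Proof. exact: measurable_funTS (measurable_powR _). Qed.

Lemma measurable_onem_powR (R : realType) (D : set R) (p : R) :
  measurable_fun D (fun x : R => (1 - x) `^ p).
Proof.
apply: measurable_funTS; apply: (measurableT_comp (measurable_powR p)).
exact: measurable_funB.
Qed.

(** The summand 1 covers the exponents p >= 0, the other one the exponents
    p < 0. *)
Lemma powR_half_bound (R : realType) (p x : R) : 2^-1 <= x -> x <= 1 ->
  x `^ p <= 1 + (2^-1) `^ p.
Proof.
move=> x2 x1; have x0 : 0 < x by lra.
have [p0|p0] := leP 0 p.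
  have : x `^ p <= 1 `^ p by apply: ge0_ler_powR => //; rewrite nnegrE; lra.
  by rewrite powR1; have := powR_ge0 (2^-1 : R) p; lra.
have h : (2^-1 : R) `^ (- p) <= x `^ (- p).
  by apply: ge0_ler_powR => //; rewrite ?nnegrE; lra.
have : x `^ p <= (2^-1) `^ p.
  rewrite -[p]opprK [leLHS]powRN [leRHS]powRN lef_pV2 ?posrE ?powR_gt0//.
lra.
Qed.

Definition beta_integrand (R : realType) (p q : R) : R -> R :=
  fun x => x `^ p * (1 - x) `^ q.

(** Euler's Beta function at (p + 1, q + 1). The shift makes p the exponent of the
    power to which the fractional integrals below are applied. *)
Definition beta_int (R : realType) (p q : R) : R :=
  \int[mu]_(x in `]0, 1[) beta_integrand p q x.

Lemma measurable_beta_integrand (R : realType) (D : set R) (p q : R) :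
  measurable_fun D (beta_integrand p q).
Proof. by apply: measurable_funM; [exact: measurable_powR_itv|exact: measurable_onem_powR]. Qed.

Lemma beta_integrand_ge0 (R : realType) (p q x : R) : 0 <= beta_integrand p q x.
Proof. by rewrite mulr_ge0 ?powR_ge0. Qed.

Lemma beta_integrand_onem (R : realType) (p q x : R) :
  beta_integrand p q (1 - x) = beta_integrand q p x.
Proof. by rewrite /beta_integrand mulrC subKr. Qed.

(** On each half of the interval one factor is bounded, so a sum of two powers
    with exponents above -1 dominates the integrand. *)
Lemma integrable_beta (R : realType) (p q : R) : -1 < p -> -1 < q ->
  mu.-integrable `]0, 1[ (EFin \o beta_integrand p q).
Proof.
move=> p1 q1.
pose C : R := 1 + (2^-1) `^ q; pose D : R := 1 + (2^-1) `^ p.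
apply: (@dominated_integrable R _ _ (fun x => C * x `^ p + D * (1 - x) `^ q)) => //.
- exact: measurable_beta_integrand.
- move=> x /=; rewrite in_itv/= => /andP[x0 x1].
  rewrite ger0_norm ?beta_integrand_ge0// /beta_integrand.
  have a0 := powR_ge0 x p; have b0 := powR_ge0 (1 - x) q.
  have c0 := powR_ge0 (2^-1 : R) q; have d0 := powR_ge0 (2^-1 : R) p.
  have [xh|xh] := leP x 2^-1.
    have : (1 - x) `^ q <= C by apply: powR_half_bound; lra.
    rewrite /D; nra.
  have : x `^ p <= D by apply: powR_half_bound; lra.
  rewrite /C; nra.
- apply: integrable_add => //; apply: integrable_scale => //.
    exact: integrable_powR.
  apply: (integrable_onem (f := fun x => x `^ q)).
    exact: measurable_powR_itv.
  exact: integrable_powR.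
Qed.

Lemma is_derive_beta (R : realType) (p q x : R) : 0 < x -> x < 1 ->
  is_derive x 1 (beta_integrand (p + 1) (q + 1))
    ((p + 1) * beta_integrand p (q + 1) x - (q + 1) * beta_integrand (p + 1) q x).
Proof.
move=> x0 x1.
have d1 : is_derive x 1 (fun y : R => 1 - y) (-1).
  have h := is_deriveB (is_derive_cst (1 : R) x 1) (is_derive_id x 1).
  by apply: is_derive1_eq h _ _ => //; rewrite sub0r.
have x1' : 0 < 1 - x by lra.
have d2 := @is_derive1_comp R (fun y => y `^ (q + 1)) (fun y => 1 - y) x _ _
  (is_derive1_powR (q + 1) x1') d1.
have h := is_deriveM (is_derive1_powR (p + 1) x0) d2.
apply: is_derive1_eq h _ _ => //.
by rewrite /GRing.scale /= /beta_integrand !addrK; ring.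
Qed.

Lemma powRS (R : realType) (p x : R) : 0 < x -> x `^ (p + 1) = x * x `^ p.
Proof.
move=> x0; rewrite powRD; last by apply/implyP => _; rewrite gt_eqF.
by rewrite powRr1 1?mulrC // ltW.
Qed.

Lemma beta_integrand_split (R : realType) (p q x : R) : 0 < x -> x < 1 ->
  beta_integrand p q x = beta_integrand (p + 1) q x + beta_integrand p (q + 1) x.
Proof.
move=> x0 x1; rewrite /beta_integrand !powRS ?subr_gt0//.
by ring.
Qed.

Lemma beta_int_split (R : realType) (p q : R) : -1 < p -> -1 < q ->
  beta_int p q = beta_int (p + 1) q + beta_int p (q + 1).
Proof.
move=> p1 q1; rewrite -RintegralD //; [|by apply: integrable_beta; lra..].
apply: eq_Rintegral => x /set_mem /=; rewrite in_itv/= => /andP[? ?].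
exact: beta_integrand_split.
Qed.

Lemma onem_powR_cvg (R : realType) (q : R) : 0 < q ->
  (1 - x) `^ q @[x --> 1^'-] --> (0 : R).
Proof.
move=> q0; apply/cvg_at_leftP => u [u1 ucvg].
apply: ((cvg_at_rightP (fun x : R => x `^ q) 0 0).1 (powR_cvg0 q0) (fun n => 1 - u n)).
split; first by move=> n; rewrite subr_gt0.
by rewrite -[X in _ --> X](subrr 1); apply: cvgB => //; exact: cvg_cst.
Qed.

(** The function x^(p+1) (1-x)^(q+1) vanishes at 0 and 1, so its derivative has
    integral 0. *)
Lemma beta_int_parts (R : realType) (p q : R) : -1 < p -> -1 < q ->
  (p + 1) * beta_int p (q + 1) = (q + 1) * beta_int (p + 1) q.
Proof.
move=> p1 q1.
have i1 : mu.-integrable `](0 : R), 1[ (EFin \o beta_integrand p (q + 1)).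
  by apply: integrable_beta; lra.
have i2 : mu.-integrable `](0 : R), 1[ (EFin \o beta_integrand (p + 1) q).
  by apply: integrable_beta; lra.
apply/eqP; rewrite -subr_eq0; apply/eqP.
rewrite -!RintegralZl // -RintegralB //; try exact: integrable_scale.
pose f := fun x => (p + 1) * beta_integrand p (q + 1) x - (q + 1) * beta_integrand (p + 1) q x.
have dF (x : R) (x0 : 0 < x) (x1 : x < 1) : is_derive x 1 (beta_integrand (p + 1) (q + 1)) (f x).
  exact: is_derive_beta.
have cbeta (p' q' : R) x : 0 < x -> x < 1 -> {for x, continuous (beta_integrand p' q')}.
  move=> x0 x1; rewrite -[p'](subrK 1) -[q'](subrK 1).
  by apply: is_derive1_continuous (is_derive_beta _ _ x0 x1).
have cf (x : R) (x0 : 0 < x) (x1 : x < 1) : {for x, continuous f}.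
  apply: cvgB; (apply: cvgM; [exact: cvg_cst|exact: cbeta]).
have onem_cvg (a : R) : a < 1 -> (1 - x) `^ (q + 1) @[x --> a] --> (1 - a) `^ (q + 1).
  move=> a1; apply: (@cvg_comp _ _ _ (fun x : R => 1 - x) (fun x => x `^ (q + 1))
      (nbhs a) (nbhs (1 - a))).
    by apply: cvgB; [exact: cvg_cst|exact: cvg_id].
  by apply: powR_continuous; lra.
have F0 : beta_integrand (p + 1) (q + 1) x @[x --> 0^'+] --> beta_integrand (p + 1) (q + 1) 0.
  apply: cvgM; first by apply: powR_cvg0_at; lra.
  by apply: cvg_at_right_filter; apply: onem_cvg.
have F1 : beta_integrand (p + 1) (q + 1) x @[x --> 1^'-] --> beta_integrand (p + 1) (q + 1) 1.
  apply: cvgM; last by rewrite subrr powR0; [apply: onem_powR_cvg; lra|lra].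
  by apply: cvg_at_left_filter; apply: powR_continuous.
rewrite (Rintegral_FTC_oo ltr01 cf dF F0 F1).
  by rewrite /beta_integrand subrr !powR0 ?mulr0 ?mul0r ?subrr //; lra.
have -> : EFin \o f = EFin \o (fun x => (p + 1) * beta_integrand p (q + 1) x +
   - (q + 1) * beta_integrand (p + 1) q x).
  by apply/funext => x /=; rewrite /f mulNr.
by apply: integrable_add => //; exact: integrable_scale.
Qed.

(** Splitting 1 = x + (1 - x) and integrating by parts give two linear equations
    between the three Beta integrals involved. *)
Lemma beta_intSl (R : realType) (p q : R) : -1 < p -> -1 < q ->
  beta_int (p + 1) q = (p + 1) / (p + q + 2) * beta_int p q.
Proof.
move=> p1 q1; have := beta_int_parts p1 q1; have := beta_int_split p1 q1.
set A := beta_int (p + 1) q; set B := beta_int p (q + 1) => -> h.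
have h0 : p + q + 2 != 0 by lra.
apply: (mulfI h0); rewrite mulrA [_ * (_ / _)]mulrC divfK //.
have : (p + q + 2) * A = (p + 1) * A + (q + 1) * A by ring.
by move=> ->; rewrite -h mulrDr.
Qed.

Lemma beta_int_sym (R : realType) (p q : R) : beta_int p q = beta_int q p.
Proof.
rewrite /beta_int Rintegral_onem; last exact: measurable_beta_integrand.
by apply: eq_Rintegral => x _; rewrite beta_integrand_onem.
Qed.

Lemma beta_intSr (R : realType) (p q : R) : -1 < p -> -1 < q ->
  beta_int p (q + 1) = (q + 1) / (p + q + 2) * beta_int p q.
Proof.
by move=> p1 q1; rewrite beta_int_sym beta_intSl // [in RHS]beta_int_sym (addrC p).
Qed.

Lemma beta_int_ge0 (R : realType) (p q : R) : 0 <= beta_int p q.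
Proof. by apply: Rintegral_ge0 => x _; exact: beta_integrand_ge0. Qed.

Lemma beta_int0 (R : realType) (p : R) : -1 < p -> beta_int p 0 = (p + 1)^-1.
Proof.
move=> p1; rewrite /beta_int.
transitivity (\int[mu]_(x in `](0 : R), 1[) (x `^ p)).
  by apply: eq_Rintegral => x _; rewrite /beta_integrand powRr0 mulr1.
by rewrite Rintegral_powR // powR1 div1r.
Qed.

Lemma beta_int_rising (R : realType) (p q : R) (k : nat) : -1 < p -> -1 < q ->
  beta_int p (q + k%:R) =
  rising (q + 1) k / rising (p + q + 2) k * beta_int p q.
Proof.
move=> p1 q1; elim: k => [|k ih].
  by rewrite addr0 /rising !big_ord0 divr1 mul1r.
have k0 : (0 : R) <= k%:R by exact: ler0n.
rewrite -natr1 addrA beta_intSr //; last lra.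
rewrite ih /rising !big_ord_recr /= invfM.
rewrite (_ : p + (q + k%:R) + 2 = p + q + 2 + k%:R); last by ring.
rewrite (_ : q + k%:R + 1 = q + 1 + k%:R); last by ring.
by ring.
Qed.

(** * Euler's integral as a limit of Beta integrals *)

Definition gamma_integrand (R : realType) (a : R) : R -> R :=
  fun x => x `^ (a - 1) * expR (- x).

Lemma gamma_integrand_ge0 (R : realType) (a x : R) : 0 <= gamma_integrand a x.
Proof. by rewrite mulr_ge0 ?powR_ge0 ?expR_ge0. Qed.

Lemma measurable_gamma_integrand (R : realType) (D : set R) (a : R) :
  measurable_fun D (gamma_integrand a).
Proof.
apply: measurable_funM; first exact: measurable_powR_itv.
apply: measurable_funTS; apply: (measurableT_comp (@measurable_expR R)).
exact: oppr_measurable.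
Qed.

Lemma integrable_expR_half (R : realType) :
  mu.-integrable `[(1 : R), +oo[ (EFin \o (fun x => expR (- (x / 2)))).
Proof.
pose F (x : R) := - (2 * expR (- (x / 2))).
have dF (x : R) : is_derive x 1 F (expR (- (x / 2))).
  have d1 : is_derive x 1 (fun y : R => - (y / 2)) (- 2^-1).
    have h := is_deriveN (is_deriveM (is_derive_id x 1) (is_derive_cst (2^-1 : R) x 1)).
    apply: is_derive1_eq h _ _ => //.
    by rewrite /GRing.scale /= mulr0 add0r mulr1.
  have d2 := @is_derive1_comp R expR (fun y => - (y / 2)) x _ _ (is_derive_expR _) d1.
  have h := is_deriveN (is_deriveM (is_derive_cst (2 : R) x 1) d2).
  apply: is_derive1_eq h _ _ => //.
  by rewrite /GRing.scale /= mulr0 addr0; field.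
have cexp (x : R) : {for x, continuous (fun x : R => expR (- (x / 2)))}.
  apply: (@cvg_comp _ _ _ (fun x : R => - (x / 2)) expR (nbhs x) (nbhs (- (x / 2)))).
    by apply: cvgN; apply: cvgMl; exact: cvg_id.
  exact: continuous_expR.
apply/integrableP; split.
  apply/measurable_EFinP; apply: measurable_funTS.
  by apply: continuous_measurable_fun => x; exact: cexp.
have -> : (\int[mu]_(x in `[1%R, +oo[) `|(EFin \o (fun x : R => expR (- (x / 2)))) x| =
    \int[mu]_(x in `[1%R, +oo[) (expR (- (x / 2)))%:E)%E.
  by apply: eq_integral => x _ /=; rewrite ger0_norm ?expR_ge0.
have -> := @ge0_continuous_FTC2y R (fun x => expR (- (x / 2))) F 1 0.
- by rewrite -EFinB ltry.
- by move=> x _; exact: expR_ge0.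
- by apply: continuous_in_subspaceT => x _; exact: cexp.
- rewrite -[X in _ --> X]oppr0 -(mulr0 2); apply: cvgN; apply: cvgMr.
  apply: (@cvg_comp _ _ _ (fun x : R => x / 2) (fun x => expR (- x)) +oo +oo).
    by apply: gt0_cvgMly => //; exact: cvg_id.
  exact: cvgr_expR.
- by move=> x _; have := dF x => h; exact: ex_derive.
- by apply: cvg_at_right_filter; exact: is_derive1_continuous (dF 1).
- by move=> x _; have := dF x => h; rewrite derive1E derive_val.
Qed.

Lemma integrable_gamma (R : realType) (a : R) : 0 < a ->
  mu.-integrable `]0, +oo[ (EFin \o gamma_integrand a).
Proof.
move=> a0.
have split : `](0 : R), +oo[%classic = `](0 : R), 1[%classic `|` `[(1 : R), +oo[%classic.
  by rewrite -itv_bndbnd_setU // bnd_simp.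
have i1 : mu.-integrable `](0 : R), 1[ (EFin \o gamma_integrand a).
  apply: (@dominated_integrable R _ _ (fun x => x `^ (a - 1))) => //.
  - exact: measurable_gamma_integrand.
  - move=> x /=; rewrite in_itv/= => /andP[x0 _].
    rewrite ger0_norm ?gamma_integrand_ge0// /gamma_integrand ler_piMr ?powR_ge0//.
    by rewrite -expR0 ler_expR; lra.
  - by apply: integrable_powR; lra.
have i2 : mu.-integrable `[(1 : R), +oo[ (EFin \o gamma_integrand a).
  (* The exponential of x / 2 beats x ^+ k.+1, which beats x `^ (a - 1). *)
  near \oo => k.
  have ka : a - 1 <= k%:R by near: k; exact: nbhs_infty_ger.
  pose C : R := 2 ^+ k.+1 * (k.+1)`!%:R.
  apply: (@dominated_integrable R _ _ (fun x => C * expR (- (x / 2)))) => //.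
  - exact: measurable_gamma_integrand.
  - move=> x /=; rewrite in_itv/= andbT => x1.
    rewrite ger0_norm ?gamma_integrand_ge0// /gamma_integrand.
    have h1 : x `^ (a - 1) <= x ^+ k.+1.
      rewrite -powR_mulrn; last lra.
      by apply: ler_powR => //; rewrite (le_trans ka)// ler_nat.
    have h2 : x ^+ k.+1 <= C * expR (x / 2).
      have : 0 <= x / 2 by lra.
      move=> /(expR_ge1Dxn k) h.
      have f0 : 0 < (k.+1)`!%:R :> R by rewrite ltr0n fact_gt0.
      have : (x / 2) ^+ k.+1 / (k.+1)`!%:R <= expR (x / 2) by lra.
      rewrite ler_pdivrMr// expr_div_n ler_pdivrMr ?exprn_gt0// => h3.
      by apply: (le_trans h3); rewrite /C le_eqVlt; apply/orP; left; apply/eqP; ring.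
    have -> : - x = - (x / 2) - x / 2 by lra.
    rewrite expRD [C * _]mulrC mulrCA ler_wpM2l ?expR_ge0//.
    by rewrite expRN ler_pdivrMr ?expR_gt0// (le_trans h1).
  - by apply: integrable_scale => //; exact: integrable_expR_half.
apply/integrableP; split.
  by apply/measurable_EFinP; exact: measurable_gamma_integrand.
rewrite split ge0_integral_setU //=.
- by apply: lte_add_pinfty; [have /integrableP[] := i1|have /integrableP[] := i2].
- apply/measurable_EFinP; apply: measurableT_comp => //.
  exact: measurable_gamma_integrand.
- by apply/disj_set2P/seteqP; split => x //= []; rewrite !in_itv/=; lra.
Unshelve. all: by end_near. Qed.

(** A bound uniform in N, to be used for dominated convergence: the exponent is at
    least N - 1, and (1 - u/N)^(N-1) <= exp (- u + u/N) <= e exp (- u). *)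
Lemma powR_onem_le (R : realType) (N u c : R) : 1 <= N -> 0 < u -> u < N ->
  -1 <= c -> (1 - u / N) `^ (N + c) <= expR 1 * expR (- u).
Proof.
move=> N1 u0 uN c1; have N0 : 0 < N by lra.
have x0 : 0 < u / N by rewrite divr_gt0.
have x1 : u / N < 1 by rewrite ltr_pdivrMr // mul1r.
rewrite /powR ifF; last by apply/negbTE; rewrite gt_eqF // subr_gt0.
rewrite -expRD ler_expR.
have l1 : ln (1 - u / N) <= - (u / N) by apply: le_ln1Dx; lra.
have l2 : (N + c) * ln (1 - u / N) <= (N - 1) * ln (1 - u / N) by nra.
have l3 : (N - 1) * ln (1 - u / N) <= (N - 1) * (- (u / N)) by nra.
have : N * (u / N) = u by rewrite mulrC divfK // gt_eqF.
nra.
Qed.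

Lemma ln_onem_ge (R : realType) (y : R) : 0 < y -> y < 1 ->
  - (y / (1 - y)) <= ln (1 - y).
Proof.
move=> y0 y1; rewrite -[X in ln X]invrK lnV ?posrE ?invr_gt0 ?subr_gt0 //.
rewrite lerN2.
have {1}-> : (1 - y)^-1 = 1 + y / (1 - y) by field; lra.
have h : 0 < y / (1 - y) by rewrite divr_gt0 // subr_gt0.
by apply: le_ln1Dx; lra.
Qed.

Lemma powR_onem_cvg (R : realType) (u c : R) : 0 < u ->
  (1 - u / n.+1%:R) `^ (n.+1%:R + c) @[n --> \oo] --> expR (- u).
Proof.
move=> u0.
have i0 : (n.+1%:R : R)^-1 @[n --> \oo] --> (0 : R) by exact: cvg_harmonic.
have x0 : u / n.+1%:R @[n --> \oo] --> (0 : R).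
  by rewrite -(mulr0 u); apply: cvgMr.
have lnc : (n.+1%:R + c) * ln (1 - u / n.+1%:R) @[n --> \oo] --> - u.
  (* Squeeze, from - y / (1 - y) <= ln (1 - y) <= - y at y = u / N. *)
  have e0 : 1 + c / n.+1%:R @[n --> \oo] --> (1 : R).
    rewrite -[X in _ --> X]addr0 -[X in 1 + X](mulr0 c); apply: cvgD; first exact: cvg_cst.
    exact: cvgMr.
  have e1 : (1 + c / n.+1%:R) * (- (u / (1 - u / n.+1%:R))) @[n --> \oo] --> - u.
    rewrite -[X in _ --> X]mul1r; apply: cvgM => //; apply: cvgN.
    rewrite -[X in _ --> X]divr1; apply: cvgMr; apply: cvgV; first exact: oner_neq0.
    by rewrite -[X in _ --> X]subr0; apply: cvgB => //; exact: cvg_cst.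
  have e2 : (1 + c / n.+1%:R) * (- u) @[n --> \oo] --> - u.
    by rewrite -[X in _ --> X]mul1r; apply: cvgMl.
  apply: squeeze_cvgr e1 e2; near=> n.
  have N0 : (0 : R) < n.+1%:R by rewrite ltr0n.
  have c1 : 0 <= 1 + c / n.+1%:R.
    by apply: ltW; near: n; apply: (cvgr_gt _ e0).
  have x1 : u / n.+1%:R < 1 by near: n; apply: (cvgr_lt _ x0).
  have xp : 0 < u / n.+1%:R by rewrite divr_gt0.
  have -> : n.+1%:R + c = (1 + c / n.+1%:R) * n.+1%:R.
    by rewrite mulrDl mul1r divfK // gt_eqF.
  rewrite -mulrA; apply/andP; split; apply: ler_wpM2l => //.
    have := ler_wpM2l (ltW N0) (ln_onem_ge xp x1).
    by rewrite mulrN [_ * (_ / _)]mulrA [_ * (u / _)]mulrC divfK // gt_eqF.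
  have h : ln (1 - u / n.+1%:R) <= - (u / n.+1%:R).
    by apply: le_ln1Dx; rewrite ltrN2.
  have := ler_wpM2l (ltW N0) h.
  by rewrite mulrN [_ * (u / _)]mulrC divfK // gt_eqF.
have : expR ((n.+1%:R + c) * ln (1 - u / n.+1%:R)) @[n --> \oo] --> expR (- u).
  by apply: continuous_cvg lnc; exact: continuous_expR.
apply: cvg_trans; apply: near_eq_cvg; near=> n.
have x1 : u / n.+1%:R < 1 by near: n; apply: (cvgr_lt _ x0).
by rewrite /powR ifF //; apply/negbTE; rewrite gt_eqF // subr_gt0.
Unshelve. all: by end_near. Qed.

Lemma beta_int_scaled (R : realType) (a c N : R) : 0 < N -> 0 < a ->
  -1 < N + c ->
  N `^ a * beta_int (N + c) (a - 1) =
  \int[mu]_(u in `]0, N[) (u `^ (a - 1) * (1 - u / N) `^ (N + c)).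
Proof.
move=> N0 a0 Nc; rewrite beta_int_sym /beta_int.
have Ni0 : N^-1 != 0 by rewrite invr_eq0 gt_eqF.
have mb (D : set R) : measurable_fun D (beta_integrand (a - 1) (N + c)).
  exact: measurable_beta_integrand.
have E : (fun x : R => N^-1 * x + 0) @^-1` `]0, 1[ = `]0, N[%classic.
  by rewrite preimage_affine_itv ?invr_gt0// subrr mul0r subr0 invrK mul1r.
have ib : mu.-integrable `](0 : R), 1[ (EFin \o beta_integrand (a - 1) (N + c)).
  by apply: integrable_beta; lra.
move: ib; rewrite (@integrable_affine R N^-1 0) // E => ib.
rewrite (@Rintegral_affine R N^-1 0) // E.
rewrite gtr0_norm ?invr_gt0// mulrA -RintegralZl //.
apply: eq_Rintegral => x /set_mem /=; rewrite in_itv /= => /andP[x0 xN].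
have {1}-> : a = (a - 1) + 1 by lra.
rewrite powRS // [N * _]mulrC mulfK ?gt_eqF // addr0 /beta_integrand mulrA.
rewrite -powRM ?(ltW N0) ?mulr_ge0 ?invr_ge0 ?(ltW N0) ?(ltW x0) //.
by rewrite mulVKf ?gt_eqF // [N^-1 * x]mulrC.
Qed.

(** Substituting u = N x turns the left-hand side into the integral over ]0, N[ of
    u^(a-1) (1 - u/N)^(N+c), whose integrand tends to that of Euler's integral
    and is dominated by e times it. The powers of n in such limits are all that
    remains of the Gamma functions when multipliers are compared. *)
Lemma beta_int_cvg_gamma (R : realType) (a c : R) : 0 < a -> -1 <= c ->
  n.+1%:R `^ a * beta_int (n.+1%:R + c) (a - 1) @[n --> \oo] --> gamma_fun a.
Proof.
move=> a0 c1.
pose f (n : nat) (u : R) := u `^ (a - 1) * (1 - u / n.+1%:R) `^ (n.+1%:R + c).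
pose g n : R -> \bar R := (EFin \o f n) \_ `]0, n.+1%:R[.
have N0 n : (0 : R) < n.+1%:R by rewrite ltr0n.
have N1 n : (1 : R) <= n.+1%:R by rewrite ler1n.
have Nc n : -1 < n.+1%:R + c by have := N1 n; lra.
have mf (D : set R) n : measurable_fun D (f n).
  apply: measurable_funM; first exact: measurable_powR_itv.
  apply: measurable_funTS; apply: (measurableT_comp (measurable_powR _)).
  by apply: measurable_funB => //; exact: mulrr_measurable.
have [] := @dominated_convergence _ _ R mu `]0, +oo[ (measurable_itv _) g
  (EFin \o gamma_integrand a) (EFin \o (fun x => expR 1 * gamma_integrand a x)).
- by move=> n; apply/measurable_restrict => //; apply/measurable_EFinP; exact: mf.
- by apply/measurable_EFinP; exact: measurable_gamma_integrand.
- apply: aeW => x /=; rewrite in_itv /= andbT => x0.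
  have h : f n x @[n --> \oo] --> gamma_integrand a x.
    by apply: cvgMr; exact: powR_onem_cvg.
  have : (f n x)%:E @[n --> \oo] --> (gamma_integrand a x)%:E.
    by apply: cvg_EFin => //; exact: nearW.
  apply: cvg_trans; apply: near_eq_cvg; near=> n.
  rewrite /g patchE ifT // inE /= in_itv /= x0 /=.
  rewrite -natr1; have : x <= n%:R by near: n; exact: nbhs_infty_ger.
  lra.
- by apply: integrable_scale => //; exact: integrable_gamma.
- apply: aeW => x n /= _; rewrite /g patchE; case: ifPn => [/set_mem /=|_].
    rewrite in_itv /= => /andP[x0 xn]; rewrite lee_fin ger0_norm; last first.
      by rewrite mulr_ge0 ?powR_ge0.
    rewrite mulrCA ler_wpM2l ?powR_ge0 //.
    exact: powR_onem_le.
  by rewrite /point /= normr0 lee_fin mulr_ge0 ?expR_ge0 ?gamma_integrand_ge0.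
move=> ig _ h.
have -> : gamma_fun a = fine (\int[mu]_(x in `]0, +oo[) (EFin \o gamma_integrand a) x) by [].
have fg : (\int[mu]_(x in `]0%R, +oo[) (EFin \o gamma_integrand a) x)%E \is a fin_num.
  exact: integrable_fin_num.
move: h; rewrite -{1}(fineK fg) => /fine_cvgP[_]; apply: cvg_trans.
apply: near_eq_cvg; apply: nearW => n /=.
rewrite beta_int_scaled // /Rintegral; congr fine.
rewrite /g -integral_mkcondr setIidr // => x /=.
by rewrite !in_itv /= andbT => /andP[].
Unshelve. all: by end_near. Qed.

Lemma gamma_fun_gt0 (R : realType) (a : R) : 0 < a -> 0 < gamma_fun a.
Proof.
move=> a0.
have ig := integrable_gamma a0.
have i12 : mu.-integrable `]1, 2[ (EFin \o gamma_integrand a).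
  apply: integrableS ig => // x /=; rewrite !in_itv/= => /andP[? _].
  by rewrite andbT; lra.
pose m : R := Num.min 1 (2 `^ (a - 1)) * expR (- 2).
have m0 : 0 < m by rewrite mulr_gt0 ?expR_gt0// lt_min ltr01 powR_gt0.
apply: (@lt_le_trans _ _ m) => //.
apply: (@le_trans _ _ (\int[mu]_(x in `]1, 2[) gamma_integrand a x)).
  have m1 : (\int[mu]_(x in `]1%R, 2%R[) m%:E = m%:E)%E.
    rewrite integral_cst //= lebesgue_measure_itv /= lte_fin ltrDl ltr01.
    by rewrite -EFinB addrK mule1.
  have {1}-> : m = \int[mu]_(x in `]1, 2[) m by rewrite /Rintegral m1.
  apply: le_Rintegral => //.
    apply/integrableP; split.
      by apply/measurable_EFinP; exact: measurable_cst.
    have -> : (\int[mu]_(x in `]1%R, 2%R[) `|(EFin \o (fun=> m)) x| =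
      \int[mu]_(x in `]1%R, 2%R[) m%:E)%E.
      by apply: eq_integral => x _ /=; rewrite gtr0_norm.
    by rewrite m1 ltry.
  move=> x /=; rewrite in_itv/= => /andP[x1 x2].
  rewrite /m /gamma_integrand ler_pM ?expR_ge0 ?le_min ?powR_ge0 ?ler01 //; last first.
    by rewrite ler_expR; lra.
  have [h|h] := leP 0 (a - 1).
    rewrite ge_min; apply/orP; left.
    have : x `^ 0 <= x `^ (a - 1) by apply: ler_powR => //; exact: ltW.
    by rewrite powRr0.
  rewrite ge_min; apply/orP; right.
  rewrite -[a - 1]opprK [leLHS]powRN [leRHS]powRN lef_pV2 ?posrE ?powR_gt0//; last lra.
  by apply: ge0_ler_powR; rewrite ?nnegrE; lra.
rewrite /gamma_fun /Rintegral fine_le //.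
- exact: integrable_fin_num i12.
- exact: integrable_fin_num ig.
apply: ge0_subset_integral => //.
- apply/measurable_EFinP; exact: measurable_gamma_integrand.
- by move=> x _; rewrite lee_fin gamma_integrand_ge0.
- move=> x /=; rewrite !in_itv/= => /andP[? _].
  by rewrite andbT; lra.
Qed.

(** * Gauss series at argument 1 *)

Lemma risingS (R : realType) (x : R) (k : nat) :
  rising x k.+1 = rising x k * (x + k%:R).
Proof. by rewrite /rising big_ord_recr. Qed.

Lemma rising0 (R : realType) (x : R) : rising x 0 = 1.
Proof. by rewrite /rising big_ord0. Qed.

Lemma risingSl (R : realType) (x : R) (k : nat) :
  rising x k.+1 = x * rising (x + 1) k.
Proof.
elim: k => [|k ih]; first by rewrite risingS !rising0 addr0 mul1r mulr1.
rewrite risingS ih risingS -mulrA; congr (_ * (_ * _)).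
by rewrite -natr1; ring.
Qed.

Lemma rising_gt0 (R : realType) (x : R) (k : nat) : 0 < x -> 0 < rising x k.
Proof. by move=> x0; apply: prodr_gt0 => i _; rewrite ltr_wpDr. Qed.

(** The terms of the Gauss series 2F1(A, B; C; z) at z = 1. *)
Definition gauss_term (R : realType) (A B C : R) : R^nat :=
  fun k => rising A k * rising B k / rising C k / k`!%:R.

Definition gauss_sum (R : realType) (A B C : R) : R :=
  limn (series (gauss_term A B C)).

Lemma gauss_termS (R : realType) (A B C : R) (k : nat) : 0 < C ->
  gauss_term A B C k.+1 =
  gauss_term A B C k * ((A + k%:R) * (B + k%:R) / (C + k%:R)) / k.+1%:R.
Proof.
move=> C0; rewrite /gauss_term !risingS factS natrM.
have f0 : k`!%:R != 0 :> R by rewrite pnatr_eq0 -lt0n fact_gt0.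
have k0 : k.+1%:R != 0 :> R by rewrite pnatr_eq0.
have c0 : C + k%:R != 0 by rewrite gt_eqF // ltr_wpDr.
have r0 : rising C k != 0 by rewrite gt_eqF // rising_gt0.
rewrite -natr1 in k0 *.
by field; rewrite f0 c0 r0 ?k0.
Qed.

(** The differences of k t_k are comparable with (C - A - B) t_k. This identity
    does the work of the asymptotics of t_k: it gives absolute convergence,
    k t_k --> 0, and the recursion of the sum in C. *)
Lemma gauss_term_step (R : realType) (A B C : R) (k : nat) : 0 < C ->
  k%:R * gauss_term A B C k - k.+1%:R * gauss_term A B C k.+1 =
  gauss_term A B C k * ((k%:R * (C - A - B) - A * B) / (C + k%:R)).
Proof.
move=> C0; rewrite gauss_termS // [k.+1%:R * _]mulrC divfK ?pnatr_eq0 //.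
have c0 : C + k%:R != 0 by rewrite gt_eqF // ltr_wpDr.
by field; exact: c0.
Qed.

(** For large k all factors of the ratio of consecutive terms are nonnegative, so
    the telescoping identity holds for the absolute values; halving the constant
    absorbs the bounded corrections. *)
Lemma gauss_term_abs_step (R : realType) (A B C : R) : 0 < C -> 0 < C - A - B ->
  \forall k \near \oo, (C - A - B) / 2 * `|gauss_term A B C k| <=
    k%:R * `|gauss_term A B C k| - k.+1%:R * `|gauss_term A B C k.+1|.
Proof.
move=> C0 D0; near=> k.
have Ak : 0 <= A + k%:R.
  have : - A <= k%:R by near: k; exact: nbhs_infty_ger.
  lra.
have Bk : 0 <= B + k%:R.
  have : - B <= k%:R by near: k; exact: nbhs_infty_ger.
  lra.
have ck : 0 < C + k%:R by rewrite ltr_wpDr.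
have Dk : (A * B + C * (C - A - B)) * 2 / (C - A - B) <= k%:R.
  by near: k; exact: nbhs_infty_ger.
have -> : k.+1%:R * `|gauss_term A B C k.+1| =
    `|gauss_term A B C k| * ((A + k%:R) * (B + k%:R) / (C + k%:R)).
  rewrite gauss_termS // normrM (ger0_norm (x := k.+1%:R^-1)) ?invr_ge0 //.
  rewrite mulrC divfK ?pnatr_eq0 // normrM; congr (_ * _).
  by rewrite ger0_norm // divr_ge0 ?mulr_ge0 // ltW.
rewrite mulrC [k%:R * _]mulrC -mulrBr ler_wpM2l //.
rewrite ler_pdivrMr // in Dk.
rewrite lerBrDr -lerBrDl ler_pdivrMr //.
nra.
Unshelve. all: by end_near. Qed.

(** The hypothesis makes series u n + d^-1 * (n * u n) nonincreasing from K on. *)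
Lemma gauss_series_bounded (R : realType) (u : R^nat) (d : R) (K : nat) :
  0 < d -> (forall n, 0 <= u n) ->
  (forall k, (K <= k)%N -> d * u k <= k%:R * u k - k.+1%:R * u k.+1) ->
  cvgn (series u).
Proof.
move=> d0 u0 step.
have mono : {homo series u : n m / (n <= m)%N >-> n <= m}.
  apply/nondecreasing_seqP => n.
  by rewrite /series /= big_nat_recr //= lerDl.
apply: nondecreasing_is_cvgn => //.
exists (series u K + d^-1 * (K%:R * u K)) => _ [n _ <-].
have [nK|Kn] := leP n K.
  apply: (le_trans (mono _ _ nK)); rewrite lerDl.
  by rewrite mulr_ge0 ?invr_ge0 ?mulr_ge0 // ltW.
apply: (@le_trans _ _ (series u n + d^-1 * (n%:R * u n))).
  by rewrite lerDl mulr_ge0 ?invr_ge0 ?mulr_ge0 // ltW.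
rewrite -(subnK (ltnW Kn)); elim: (n - K)%N => [|j ih]; first by rewrite add0n.
apply: le_trans ih; rewrite addSn {1}/series /= big_nat_recr //= -/(series u _).
rewrite -addrA lerD2l -(ler_pM2l d0) mulrDr !mulrA divff ?gt_eqF // !mul1r.
by have := step (j + K)%N (leq_addl _ _); lra.
Qed.

Lemma is_cvg_series_shift (R : realType) (u : R^nat) (N : nat) :
  cvgn (series u) -> cvgn (series (fun k => u (k + N)%N)).
Proof.
move=> cu.
have -> : series (fun k => u (k + N)%N) = (fun n => series u (n + N)%N - series u N).
  apply/funext => n; rewrite /series /=.
  rewrite (@big_cat_nat _ _ _ N 0 (n + N)) //= ?leq_addl //.
  rewrite [X in X - _]addrC addrK -{2}[N]add0n big_addn addnK.
  by [].
apply: is_cvgB; last exact: is_cvg_cst.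
by apply/cvg_ex; exists (limn (series u)); rewrite (cvg_shiftn N (series u)).
Qed.

(** The sequence k u_k is eventually nonincreasing, hence convergent, and its limit
    is 0 because the series of u converges and the harmonic series does not. *)
Lemma gauss_series_vanish (R : realType) (u : R^nat) (d : R) (K : nat) :
  0 < d -> (forall n, 0 <= u n) ->
  (forall k, (K <= k)%N -> d * u k <= k%:R * u k - k.+1%:R * u k.+1) ->
  k%:R * u k @[k --> \oo] --> (0 : R).
Proof.
move=> d0 u0 step; have cu := gauss_series_bounded d0 u0 step.
pose v k : R := (k + K)%:R * u (k + K)%N.
have v0 k : 0 <= v k by rewrite mulr_ge0.
have vmono : {homo v : n m / (n <= m)%N >-> m <= n}.
  apply/nonincreasing_seqP => n; rewrite /v addSn.
  by have := step (n + K)%N (leq_addl _ _); have := mulr_ge0 (ltW d0) (u0 (n + K)%N); lra.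
have cv : cvgn v.
  by apply: nonincreasing_is_cvgn => //; exists 0 => _ [n _ <-].
have L0 : 0 <= limn v by apply: limr_ge => //; exact: nearW.
(* A positive limit of v would bound the harmonic series by a multiple of the
   series of u. *)
suff Lz : limn v = 0.
  have : v @ \oo --> (0 : R) by rewrite -Lz.
  by rewrite -[in X in _ -> X](cvg_shiftn K (fun k => k%:R * u k)).
apply/eqP; rewrite eq_le L0 andbT leNgt; apply/negP => Lpos.
apply: (@dvg_harmonic R).
apply: (@series_le_cvg R _ ((K.+1%:R / limn v) *: (fun k => u (k + K.+1)%N))).
- by move=> n; rewrite /harmonic /= invr_ge0.
- by move=> n; rewrite /GRing.scale /= mulr_ge0 ?divr_ge0 // ltW.
- move=> n; have := nonincreasing_cvgn_ge vmono cv n.+1.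
  rewrite {2}/v addSnnS => h; set w := u (n + K.+1)%N in h.
  have n0 : 0 < n.+1%:R :> R by rewrite ltr0n.
  suff : n.+1%:R^-1 <= K.+1%:R / limn v * w by [].
  have h2 : limn v <= K.+1%:R * n.+1%:R * w.
    apply: (le_trans h); rewrite ler_wpM2r //; first exact: u0.
    by rewrite -natrM ler_nat; nia.
  rewrite -div1r ler_pdivrMr // (_ : _ * _ * _ = (K.+1%:R * n.+1%:R * w) / limn v).
    by rewrite ler_pdivlMr // mul1r.
  by ring.
- by apply: is_cvg_seriesZ; exact: is_cvg_series_shift.
Qed.

Lemma gauss_term_eventually (R : realType) (A B C : R) : 0 < C -> 0 < C - A - B ->
  exists K : nat, forall k, (K <= k)%N ->
    (C - A - B) / 2 * `|gauss_term A B C k| <=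
    k%:R * `|gauss_term A B C k| - k.+1%:R * `|gauss_term A B C k.+1|.
Proof.
move=> C0 D0; have [K _ HK] := gauss_term_abs_step C0 D0.
by exists K => k Kk; apply: HK.
Qed.

Lemma gauss_abs_cvg (R : realType) (A B C : R) : 0 < C -> 0 < C - A - B ->
  cvgn (series (fun k => `|gauss_term A B C k|)).
Proof.
move=> C0 D0; have [K HK] := gauss_term_eventually C0 D0.
apply: (@gauss_series_bounded _ _ ((C - A - B) / 2) K _ _ HK) => //.
by rewrite divr_gt0.
Qed.

Lemma gauss_cvg (R : realType) (A B C : R) : 0 < C -> 0 < C - A - B ->
  cvgn (series (gauss_term A B C)).
Proof. by move=> C0 D0; apply: normed_cvg; exact: gauss_abs_cvg. Qed.

Lemma gauss_term_vanish (R : realType) (A B C : R) : 0 < C -> 0 < C - A - B ->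
  k%:R * gauss_term A B C k @[k --> \oo] --> (0 : R).
Proof.
move=> C0 D0; have [K HK] := gauss_term_eventually C0 D0.
have d0 : 0 < (C - A - B) / 2 by rewrite divr_gt0.
have := gauss_series_vanish d0 (fun n => normr_ge0 (gauss_term A B C n)) HK.
move=> h; apply/norm_cvg0P; apply: cvg_trans h; apply: near_eq_cvg.
by apply: nearW => k /=; rewrite [RHS]normrM normr_nat.
Qed.

Lemma series_telescope_eq (R : realType) (f g v : R^nat) (a b c : R) :
  cvgn (series f) -> cvgn (series g) -> v @ \oo --> c ->
  (forall k, a * f k - b * g k = v k - v k.+1) ->
  a * limn (series f) - b * limn (series g) = v 0%N - c.
Proof.
move=> cf cg cv E.
have h1 : a * series f n - b * series g n @[n --> \oo] -->
    a * limn (series f) - b * limn (series g).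
  by apply: cvgB; apply: cvgMr.
have h2 : v 0%N - v n @[n --> \oo] --> v 0%N - c.
  by apply: cvgB => //; exact: cvg_cst.
have EE n : a * series f n - b * series g n = v 0%N - v n.
  elim: n => [|n ih]; first by rewrite /series /= !big_geq // !mulr0 !subrr.
  rewrite /series /= !big_nat_recr //= -/(series f n) -/(series g n).
  rewrite !mulrDr opprD addrACA ih E; ring.
have {h2}h1' : a * series f n - b * series g n @[n --> \oo] --> v 0%N - c.
  by under eq_fun do rewrite EE.
by rewrite -(cvg_lim _ h1) // -(cvg_lim _ h1').
Qed.

(** Termwise, the difference of the two sides is the increment of C k t_k, which
    tends to 0. Together with the limit of the sum along C + n, this recursion
    determines the sum. *)
Lemma gauss_sum_rec (R : realType) (A B C : R) : 0 < C -> 0 < C - A - B ->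
  C * (C - A - B) * gauss_sum A B C =
  (C - A) * (C - B) * gauss_sum A B (C + 1).
Proof.
move=> C0 D0; apply/eqP; rewrite -subr_eq0; apply/eqP.
have C10 : 0 < C + 1 by lra.
have D10 : 0 < C + 1 - A - B by lra.
rewrite (@series_telescope_eq _ _ _ (fun k => C * (k%:R * gauss_term A B C k)) _ _ 0).
- by rewrite mul0r mulr0 subrr.
- exact: gauss_cvg.
- exact: gauss_cvg.
- by rewrite -(mulr0 C); apply: cvgMr; exact: gauss_term_vanish.
move=> k; rewrite -mulrBr gauss_term_step //.
have ck : C + k%:R != 0 by rewrite gt_eqF // ltr_wpDr.
have rk : rising C k != 0 by rewrite gt_eqF // rising_gt0.
have -> : gauss_term A B (C + 1) k = gauss_term A B C k * (C / (C + k%:R)).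
  rewrite /gauss_term.
  have : C * rising (C + 1) k = rising C k * (C + k%:R) by rewrite -risingSl risingS.
  have r1k : rising (C + 1) k != 0 by rewrite gt_eqF // rising_gt0.
  move=> h; have -> : (rising (C + 1) k)^-1 = (rising C k)^-1 * (C / (C + k%:R)).
    apply: (mulfI r1k); rewrite divff // mulrCA -[LHS](mulVf rk); congr (_ * _).
    by rewrite mulrA [_ * C]mulrC h mulfK.
  by ring.
by field; rewrite ck.
Qed.

Lemma gauss_term0 (R : realType) (A B C : R) : gauss_term A B C 0 = 1.
Proof. by rewrite /gauss_term !rising0 fact0 !divr1 mulr1. Qed.

Lemma gauss_term_cvg0 (R : realType) (A B C : R) : 0 < C -> 0 < C - A - B ->
  gauss_term A B C @ \oo --> (0 : R).
Proof. by move=> C0 D0; apply: cvg_series_cvg_0; exact: gauss_cvg. Qed.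

(** The relation between neighbouring Gauss sums which says, at the level of
    multipliers, that the order zero operator is the derivative of the order one
    operator. *)
Lemma gauss_sum_contig (R : realType) (A B C : R) : 0 < C -> 0 < C - A - B ->
  C * gauss_sum A B C = (C - A) * gauss_sum A (B + 1) (C + 1).
Proof.
move=> C0 D0; apply/eqP; rewrite -subr_eq0; apply/eqP.
have C10 : 0 < C + 1 by lra.
have D10 : 0 < C + 1 - A - (B + 1) by lra.
pose w := gauss_term A (B + 1) (C + 1).
(* A discrete antiderivative of the difference of the two summands; the empty
   sum fixes its value at 0. *)
pose V k := if k is k'.+1 then - ((A + k'%:R) * w k') else 0.
rewrite (@series_telescope_eq _ _ _ V _ _ 0).
- by rewrite subrr.
- exact: gauss_cvg.
- exact: gauss_cvg.
- suff h : (fun n => - ((A + n%:R) * w n)) @ \oo --> (0 : R) by rewrite -cvg_shiftS.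
  rewrite -[X in _ --> X]oppr0; apply: cvgN.
  rewrite -[X in _ --> X]addr0 -[X in X + 0](mulr0 A).
  under eq_fun do rewrite mulrDl.
  apply: cvgD; first by apply: cvgMr; exact: gauss_term_cvg0.
  exact: gauss_term_vanish.
case=> [|k]; first by rewrite /V /w !gauss_term0 addr0; ring.
rewrite /V /w gauss_termS // gauss_termS // -!natr1.
have ck : C + k%:R != 0 by rewrite gt_eqF // ltr_wpDr.
have c1k : C + 1 + k%:R != 0 by rewrite gt_eqF // ltr_wpDr.
have rk : rising C k != 0 by rewrite gt_eqF // rising_gt0.
have r1k : rising (C + 1) k != 0 by rewrite gt_eqF // rising_gt0.
have fk : k`!%:R != 0 :> R by rewrite pnatr_eq0 -lt0n fact_gt0.
have k1 : k%:R + 1 != 0 :> R by rewrite natr1 pnatr_eq0.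
have hC : C * rising (C + 1) k = rising C k * (C + k%:R) by rewrite -risingSl risingS.
have hB : B * rising (B + 1) k = rising B k * (B + k%:R) by rewrite -risingSl risingS.
have E : C * (gauss_term A B C k * ((A + k%:R) * (B + k%:R) / (C + k%:R)) / (k%:R + 1)) =
    (A + k%:R) * gauss_term A (B + 1) (C + 1) k * (B / (k%:R + 1)).
  rewrite /gauss_term.
  transitivity (rising A k * (rising B k * (B + k%:R)) * (A + k%:R) * C /
    (rising C k * (C + k%:R)) / k`!%:R / (k%:R + 1)).
    by field; rewrite ck rk fk k1.
  rewrite -hC -hB; field.
  by rewrite r1k fk k1 gt_eqF.
rewrite E.
by field; rewrite ?c1k ?k1.
Qed.

(** The term of index 0 is 1; each of the others is at most C / (C + n) times its
    value at n = 0, uniformly in the index. *)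
Lemma gauss_sum_cvg1 (R : realType) (A B C : R) : 0 < C -> 0 < C - A - B ->
  gauss_sum A B (C + n%:R) @[n --> \oo] --> (1 : R).
Proof.
move=> C0 D0.
pose L := limn (series (fun k => `|gauss_term A B C k|)).
have n0 n : (0 : R) <= n%:R by exact: ler0n.
have Cn n : 0 < C + n%:R by rewrite ltr_wpDr.
have Dn n : 0 < C + n%:R - A - B by have := n0 n; lra.
have cge n : 0 <= C / (C + n%:R) by rewrite divr_ge0 // ltW.
have bnd n k : `|gauss_term A B (C + n%:R) k.+1| <=
    C / (C + n%:R) * `|gauss_term A B C k.+1|.
  have r0 j : 0 < rising C j by exact: rising_gt0.
  have rn0 j : 0 < rising (C + n%:R) j by exact: rising_gt0.
  have rge j : 0 <= rising C j / rising (C + n%:R) j.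
    by rewrite divr_ge0 // ltW.
  have -> : gauss_term A B (C + n%:R) k.+1 =
      rising C k.+1 / rising (C + n%:R) k.+1 * gauss_term A B C k.+1.
    rewrite /gauss_term; field.
    by rewrite !gt_eqF // ltr0n fact_gt0.
  rewrite [leLHS]normrM ler_wpM2r // ger0_norm ?rge //.
  elim: k => [|k ih]; first by rewrite !risingS !rising0 !mul1r !addr0.
  rewrite risingS [X in _ / X]risingS invfM.
  have -> : rising C k.+1 * (C + k.+1%:R) * 
    ((rising (C + n%:R) k.+1)^-1 * (C + n%:R + k.+1%:R)^-1) =
    (rising C k.+1 / rising (C + n%:R) k.+1) * ((C + k.+1%:R) / (C + n%:R + k.+1%:R)) by ring.
  apply: le_trans ih; apply: ler_piMr; first exact: rge.
  by rewrite ler_pdivrMr ?ltr_wpDr // mul1r lerD2r lerDl.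
have sb n N : `|series (gauss_term A B (C + n%:R)) N.+1 - 1| <= C / (C + n%:R) * L.
  have : series (fun k => `|gauss_term A B C k|) N.+1 <= L.
    apply: nondecreasing_cvgn_le; last exact: gauss_abs_cvg.
    by apply/nondecreasing_seqP => j; rewrite /series /= big_nat_recr //= lerDl.
  move=> h; apply: (@le_trans _ _
    (C / (C + n%:R) * series (fun k => `|gauss_term A B C k|) N.+1)); last first.
    by rewrite ler_wpM2l // cge.
  rewrite /series /= !big_nat_recl //= gauss_term0 addrC addKr.
  apply: (le_trans (ler_norm_sum _ _ _)); rewrite mulrDr mulr_sumr.
  apply: ler_wpDl; first by rewrite mulr_ge0 ?cge.
  by apply: ler_sum => k _; exact: bnd.
have lb n : `|gauss_sum A B (C + n%:R) - 1| <= C / (C + n%:R) * L.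
  have h : `|series (gauss_term A B (C + n%:R)) N.+1 - 1| @[N --> \oo] -->
      `|gauss_sum A B (C + n%:R) - 1|.
    apply: cvg_norm; apply: cvgB; last exact: cvg_cst.
    by rewrite (cvg_shiftS (series _)); exact: gauss_cvg.
  rewrite -(cvg_lim _ h) //; apply: limr_le; first by apply/cvg_ex; eexists; exact: h.
  by apply: nearW => N; exact: sb.
apply/cvgrPdist_le => e e0; near=> n.
rewrite distrC (le_trans (lb n)) // mulrAC ler_pdivrMr //.
have : (C * L) / e <= n%:R by near: n; exact: nbhs_infty_ger.
rewrite ler_pdivrMr // => h; have := mulr_ge0 (ltW e0) (ltW C0); lra.
Unshelve. all: by end_near. Qed.

(** * Multipliers of the Saigo operators on powers *)

(** The quotient Gamma(p+1) / Gamma(p+1+a), extended to a = 0 by its limit. *)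
Definition beta_mult (R : realType) (a p : R) : R :=
  if a == 0 then 1 else beta_int p (a - 1) / gamma_fun a.

Lemma beta_mult_rec (R : realType) (a p : R) : 0 <= a -> -1 < p ->
  (p + 1) * beta_mult a p = (p + 1 + a) * beta_mult a (p + 1).
Proof.
move=> a0 p1; rewrite /beta_mult; case: eqVneq => [->|an0]; first by rewrite addr0.
have ap : 0 < a by rewrite lt_neqAle eq_sym an0.
rewrite beta_intSl //; last lra.
rewrite (_ : p + (a - 1) + 2 = p + 1 + a); last by ring.
have h : p + 1 + a != 0 by lra.
by field; rewrite h gt_eqF // gamma_fun_gt0.
Qed.

Lemma beta_mult_cvg1 (R : realType) (a p : R) : 0 <= a -> -1 < p ->
  n.+1%:R `^ a * beta_mult a (p + n.+1%:R) @[n --> \oo] --> (1 : R).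
Proof.
move=> a0 p1; rewrite /beta_mult; case: eqVneq => [->|an0].
  by under eq_fun do rewrite powRr0 mul1r; exact: cvg_cst.
have ap : 0 < a by rewrite lt_neqAle eq_sym an0.
have g0 := gamma_fun_gt0 ap.
rewrite [X in _ --> X](_ : 1 = gamma_fun a / gamma_fun a); last first.
  by rewrite divff // gt_eqF.
under eq_fun do rewrite mulrA [p + _]addrC.
by apply: cvgMl; apply: beta_int_cvg_gamma => //; exact: ltW.
Qed.

(** The factor by which the Saigo operator of order a multiplies t^p, the result
    being a multiple of t^(p-b). Gauss's formula would make it
    Gamma(p+1) Gamma(p+1-b+c) / (Gamma(p+1-b) Gamma(p+1+a+c)); what is
    used of this closed form is its recursion in p and its growth along p + n. *)
Definition saigo_mult (R : realType) (a b c p : R) : R :=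
  beta_mult a p * gauss_sum (a + b) (- c) (p + 1 + a).

Lemma saigo_mult_rec (R : realType) (a b c p : R) : 0 <= a -> -1 < p ->
  b - c - 1 < p ->
  (p + 1) * (p + 1 - b + c) * saigo_mult a b c p =
  (p + 1 - b) * (p + 1 + a + c) * saigo_mult a b c (p + 1).
Proof.
move=> a0 p1 p2; rewrite /saigo_mult.
have C0 : 0 < p + 1 + a by lra.
have D0 : 0 < p + 1 + a - (a + b) - (- c) by lra.
have h1 := beta_mult_rec a0 p1.
have h2 := gauss_sum_rec C0 D0.
rewrite (_ : p + 1 + 1 + a = p + 1 + a + 1); last by ring.
set S := gauss_sum _ _ _ in h2 *; set S' := gauss_sum _ _ (_ + 1) in h2 *.
transitivity (((p + 1) * beta_mult a p) * ((p + 1 - b + c) * S)); first by ring.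
rewrite h1.
transitivity (beta_mult a (p + 1) * ((p + 1 + a) * (p + 1 + a - (a + b) - - c) * S)).
  by ring.
by rewrite h2; ring.
Qed.

Lemma saigo_mult_cvg1 (R : realType) (a b c p : R) : 0 <= a -> -1 < p ->
  b - c - 1 < p ->
  n.+1%:R `^ a * saigo_mult a b c (p + n.+1%:R) @[n --> \oo] --> (1 : R).
Proof.
move=> a0 p1 p2; rewrite -[X in _ --> X]mulr1 /saigo_mult.
under eq_fun do rewrite mulrA.
apply: cvgM; first exact: beta_mult_cvg1.
have h : gauss_sum (a + b) (- c) (p + 1 + a + n%:R) @[n --> \oo] --> (1 : R).
  by apply: gauss_sum_cvg1; lra.
rewrite -cvg_shiftS in h; apply: cvg_trans h; apply: near_eq_cvg; apply: nearW => n /=.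
by congr gauss_sum; ring.
Qed.

Lemma rising_cvg1 (R : realType) (p : R) (m : nat) :
  rising (p + n.+1%:R) m / n.+1%:R `^ m%:R @[n --> \oo] --> (1 : R).
Proof.
elim: m => [|m ih].
  by under eq_fun do rewrite rising0 powRr0 divr1; exact: cvg_cst.
rewrite -[X in _ --> X]mulr1.
have -> : (fun n => rising (p + n.+1%:R) m.+1 / n.+1%:R `^ m.+1%:R) =
  (fun n => (rising (p + n.+1%:R) m / n.+1%:R `^ m%:R) * (1 + (p + m%:R) / n.+1%:R)).
  apply/funext => n; rewrite risingS -(natr1 m) powRS // invfM.
  have n0 : n.+1%:R != 0 :> R by rewrite pnatr_eq0.
  have n1 : n.+1%:R `^ m%:R != 0 :> R by rewrite gt_eqF // powR_gt0.
  by move: (n.+1%:R : R) n0 n1 => N n0 n1; field; rewrite n0 n1.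
apply: cvgM => //; rewrite -[X in _ --> X]addr0 -[X in 1 + X](mulr0 (p + m%:R)).
apply: cvgD; first exact: cvg_cst.
by apply: cvgMr; exact: cvg_harmonic.
Qed.

(** By the recursions of the three factors, the quotient Q of the two sides is
    1-periodic in p. Along p + n the powers of n coming from the asymptotics
    cancel and Q tends to 1, so Q = 1. *)
Lemma saigo_mult_compose (R : realType) (alpha beta gamma p : R) (m : nat) :
  0 < alpha -> alpha <= m%:R ->
  Num.max 0 (- beta - m%:R - alpha - gamma) - 1 < p ->
  Num.max 0 (beta - gamma) - 1 < p + beta + m%:R ->
  saigo_mult alpha beta gamma (p + beta + m%:R) *
  saigo_mult (m%:R - alpha) (- beta - m%:R) (alpha + gamma) p =
  (rising (p + 1) m)^-1.
Proof.
move=> a0 am h1 h2.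
have p1 : -1 < p by move: h1; rewrite ltrBlDr gt_max; lra.
have p2 : - beta - m%:R - alpha - gamma - 1 < p.
  by move: h1; rewrite ltrBlDr gt_max; lra.
have p3 : -1 < p + beta + m%:R by move: h2; rewrite ltrBlDr gt_max; lra.
have p4 : beta - gamma - 1 < p + beta + m%:R.
  by move: h2; rewrite ltrBlDr gt_max; lra.
have m0 : (0 : R) <= m%:R by exact: ler0n.
pose Q x := rising (x + 1) m *
  (saigo_mult alpha beta gamma (x + beta + m%:R) *
  saigo_mult (m%:R - alpha) (- beta - m%:R) (alpha + gamma) x).
suff Q1 : Q p = 1.
  by apply: (mulfI (_ : rising (p + 1) m != 0)); rewrite ?divff // gt_eqF // rising_gt0 //; lra.
have Qrec x : p <= x -> Q x = Q (x + 1).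
  move=> px; rewrite /Q.
  have r1 := @saigo_mult_rec R alpha beta gamma (x + beta + m%:R).
  have {r1}r1 := r1 (ltW a0) ltac:(lra) ltac:(lra).
  have r2 := @saigo_mult_rec R (m%:R - alpha) (- beta - m%:R) (alpha + gamma) x.
  have {r2}r2 := r2 ltac:(lra) ltac:(lra) ltac:(lra).
  have r3 : (x + 1) * rising (x + 1 + 1) m = rising (x + 1) m * (x + 1 + m%:R).
    by rewrite -risingSl risingS.
  move: r1 r2.
  rewrite (_ : x + 1 + beta + m%:R = x + beta + m%:R + 1); last by ring.
  set A := saigo_mult alpha _ _ _; set A' := saigo_mult alpha _ _ (_ + 1).
  set B := saigo_mult (m%:R - alpha) _ _ _; set B' := saigo_mult (m%:R - alpha) _ _ (_ + 1).
  move=> r1 r2.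
  (* K is the product of the factors on the left of r1 and r2, which are
     positive for x >= p. *)
  pose K := (x + 1) * (x + beta + m%:R + 1) * (x + beta + m%:R + 1 + alpha + gamma) *
    (x + 1 + m%:R + gamma).
  have K0 : K != 0.
    by rewrite /K !mulf_neq0 //; rewrite gt_eqF //; lra.
  apply: (mulfI K0).
  transitivity (rising (x + 1) m *
    ((x + beta + m%:R + 1) * (x + beta + m%:R + 1 - beta + gamma) * A) *
    ((x + 1) * (x + 1 - (- beta - m%:R) + (alpha + gamma)) * B)).
    by rewrite /K; ring.
  rewrite r1 r2.
  transitivity ((rising (x + 1) m * (x + 1 + m%:R)) * (x + beta + m%:R + 1) *
     (x + beta + m%:R + 1 + alpha + gamma) * (x + 1 + m%:R + gamma) * A' * B').
    by ring.
  by rewrite -r3 /K; ring.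
have Qn n : Q p = Q (p + n%:R).
  elim: n => [|n ih]; first by rewrite addr0.
  by rewrite ih -natr1 addrA Qrec // lerDl.
have Qc : Q (p + n.+1%:R) @[n --> \oo] --> (1 : R).
  have c1 := saigo_mult_cvg1 (ltW a0) p3 p4.
  have c2 := @saigo_mult_cvg1 R (m%:R - alpha) (- beta - m%:R) (alpha + gamma) p.
  have {c2}c2 := c2 ltac:(lra) ltac:(lra) ltac:(lra).
  have c3 := rising_cvg1 (p + 1) m.
  have h : (rising (p + 1 + n.+1%:R) m / n.+1%:R `^ m%:R) *
      ((n.+1%:R `^ alpha *
        saigo_mult alpha beta gamma (p + beta + m%:R + n.+1%:R)) *
       (n.+1%:R `^ (m%:R - alpha) *
        saigo_mult (m%:R - alpha) (- beta - m%:R) (alpha + gamma) (p + n.+1%:R)))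
      @[n --> \oo] --> (1 * (1 * 1) : R).
    by apply: cvgM => //; exact: cvgM.
  rewrite !mulr1 in h.
  apply: cvg_trans h; apply: near_eq_cvg.
  apply: nearW => n /=.
  rewrite /Q (_ : p + n.+1%:R + 1 = p + 1 + n.+1%:R); last by ring.
  rewrite (_ : p + n.+1%:R + beta + m%:R = p + beta + m%:R + n.+1%:R); last by ring.
  have -> : n.+1%:R `^ m%:R = n.+1%:R `^ alpha * n.+1%:R `^ (m%:R - alpha) :> R.
    rewrite -powRD; first by congr (_ `^ _); ring.
    by apply/implyP; rewrite pnatr_eq0.
  have n1 : n.+1%:R `^ alpha != 0 :> R by rewrite gt_eqF // powR_gt0.
  have n2 : n.+1%:R `^ (m%:R - alpha) != 0 :> R by rewrite gt_eqF // powR_gt0.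
  by move: (n.+1%:R : R) n1 n2 => N n1 n2; field; rewrite n1 n2.
have : Q p @[n --> \oo] --> (1 : R).
  by move: Qc; under eq_fun do rewrite -Qn.
by move/cvg_lim => <- //; rewrite lim_cst.
Qed.

(** * Power series kernels and their moments *)

(** The shape taken by the kernels of all Saigo operators after the substitution
    s = t x. *)
Definition series_kernel (R : realType) (a : R) (c : R^nat) (x : R) : R :=
  (1 - x) `^ (a - 1) * limn (series (fun k => c k * (1 - x) ^+ k)).

Lemma measurable_power_partial (R : realType) (D : set R) (c : R^nat) (n : nat) :
  measurable_fun D (fun x : R => series (fun k => c k * (1 - x) ^+ k) n).
Proof.
elim: n => [|n ih].
  rewrite (_ : (fun x : R => _) = cst 0); first exact: measurable_cst.
  by apply/funext => x; rewrite /series /= big_geq.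
rewrite (_ : (fun x : R => _) =
    (fun x : R => series (fun k => c k * (1 - x) ^+ k) n + c n * (1 - x) ^+ n)); last first.
  by apply/funext => x; rewrite /series /= big_nat_recr.
apply: measurable_funD => //; apply: measurable_funM => //.
by apply: measurable_funX; apply: measurable_funB.
Qed.

Lemma beta_integrand_shift (R : realType) (p q x : R) (k : nat) : x < 1 ->
  beta_integrand p q x * (1 - x) ^+ k = beta_integrand p (q + k%:R) x.
Proof.
move=> x1; rewrite /beta_integrand -mulrA; congr (_ * _).
rewrite powRD ?powR_mulrn //; first lra.
by apply/implyP => _; rewrite gt_eqF // subr_gt0.
Qed.

(** Beta integrals decrease in k no faster than any geometric sequence of ratio
    below 1: restrict the integral to ]0, x[. Hence summability of c against them
    forces the power series of c to converge on the open unit disc. *)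
Lemma beta_int_ge (R : realType) (p a x : R) : -1 < p -> 0 < a -> 0 < x -> x < 1 ->
  exists2 w : R, 0 < w & forall k : nat, w * (1 - x) ^+ k <= beta_int p (a - 1 + k%:R).
Proof.
move=> p1 a0 x0 x1.
pose m : R := Num.min 1 ((1 - x) `^ (a - 1)).
have m0 : 0 < m by rewrite lt_min ltr01 powR_gt0 // subr_gt0.
exists (m * (x `^ (p + 1) / (p + 1))).
  by rewrite mulr_gt0 // divr_gt0 ?powR_gt0 //; lra.
move=> k.
have k0 : (0 : R) <= k%:R by exact: ler0n.
have ib : mu.-integrable `](0 : R), 1[ (EFin \o beta_integrand p (a - 1 + k%:R)).
  by apply: integrable_beta; lra.
have sub : `](0 : R), x[ `<=` `](0 : R), 1[.
  by move=> y /=; rewrite !in_itv/= => /andP[? ?]; apply/andP; split; lra.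
have ibx : mu.-integrable `]0, x[ (EFin \o beta_integrand p (a - 1 + k%:R)).
  exact: integrableS ib.
apply: (@le_trans _ _ (\int[mu]_(y in `]0, x[) beta_integrand p (a - 1 + k%:R) y)).
  have -> : m * (x `^ (p + 1) / (p + 1)) * (1 - x) ^+ k =
      \int[mu]_(y in `]0, x[) (m * (1 - x) ^+ k * y `^ p).
    by rewrite RintegralZl ?Rintegral_powR //; [ring|exact: integrable_powR].
  apply: le_Rintegral => //.
    by apply: integrable_scale => //; exact: integrable_powR.
  move=> y /=; rewrite in_itv/= => /andP[y0 yx].
  have y1 : y < 1 by lra.
  rewrite -beta_integrand_shift // /beta_integrand -[leRHS]mulrA [leLHS]mulrC.
  rewrite ler_wpM2l ?powR_ge0 //.
  rewrite ler_pM ?powR_ge0 ?exprn_ge0 ?(ltW m0) ?subr_ge0 ?(ltW x1) //.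
  + have [h|h] := leP (a - 1) 0.
      rewrite ge_min; apply/orP; left.
      have : (1 - y) `^ 0 <= (1 - y) `^ (a - 1) by apply: ger_powR => //; apply/andP; split; lra.
      by rewrite powRr0.
    rewrite ge_min; apply/orP; right.
    by apply: ge0_ler_powR; rewrite ?nnegrE; lra.
  + by apply: lerXn2r; rewrite ?nnegrE; lra.
rewrite /beta_int /Rintegral fine_le //.
- exact: integrable_fin_num.
- exact: integrable_fin_num.
apply: ge0_subset_integral => //.
  by apply/measurable_EFinP; exact: measurable_beta_integrand.
by move=> y _; rewrite lee_fin beta_integrand_ge0.
Qed.

Lemma power_series_abs_cvg (R : realType) (p a x : R) (c : R^nat) :
  -1 < p -> 0 < a -> 0 < x -> x < 1 ->
  cvgn (series (fun k => `|c k| * beta_int p (a - 1 + k%:R))) ->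
  cvgn (series (fun k => `|c k * (1 - x) ^+ k|)).
Proof.
move=> p1 a0 x0 x1 cv; have [w w0 hw] := beta_int_ge p1 a0 x0 x1.
apply: (@series_le_cvg R _ (w^-1 *: (fun k => `|c k| * beta_int p (a - 1 + k%:R)))) => //.
- move=> n; suff : 0 <= w^-1 * (`|c n| * beta_int p (a - 1 + n%:R)) by [].
  by rewrite !mulr_ge0 ?invr_ge0 ?(ltW w0) ?beta_int_ge0.
- move=> n; suff : `|c n * (1 - x) ^+ n| <= w^-1 * (`|c n| * beta_int p (a - 1 + n%:R)) by [].
  rewrite [leRHS]mulrC ler_pdivlMr // [leLHS]mulrC normrM mulrCA ler_wpM2l //.
  by rewrite ger0_norm ?exprn_ge0 ?subr_ge0 ?(ltW x1).
- exact: is_cvg_seriesZ.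
Qed.

Lemma power_series_cvg (R : realType) (p a x : R) (c : R^nat) :
  -1 < p -> 0 < a -> 0 < x -> x < 1 ->
  cvgn (series (fun k => `|c k| * beta_int p (a - 1 + k%:R))) ->
  cvgn (series (fun k => c k * (1 - x) ^+ k)).
Proof.
by move=> p1 a0 x0 x1 cv; apply: normed_cvg; exact: power_series_abs_cvg cv.
Qed.

Lemma measurable_series_kernel (R : realType) (p a : R) (c : R^nat) :
  -1 < p -> 0 < a ->
  cvgn (series (fun k => `|c k| * beta_int p (a - 1 + k%:R))) ->
  measurable_fun `](0 : R), 1[ (series_kernel a c).
Proof.
move=> p1 a0 cv; apply: measurable_funM; first exact: measurable_onem_powR.
apply: (measurable_fun_cvg (h := fun n (x : R) => series (fun k => c k * (1 - x) ^+ k) n)).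
  by move=> n; exact: measurable_power_partial.
move=> x /=; rewrite in_itv/= => /andP[x0 x1].
exact: power_series_cvg cv.
Qed.

Lemma integral_power_partial (R : realType) (p a : R) (c : R^nat) (n : nat) :
  -1 < p -> 0 < a ->
  let F x := beta_integrand p (a - 1) x * series (fun k => c k * (1 - x) ^+ k) n in
  mu.-integrable `]0, 1[ (EFin \o F) /\
  \int[mu]_(x in `]0, 1[) F x = series (fun k => c k * beta_int p (a - 1 + k%:R)) n.
Proof.
move=> p1 a0; elim: n => [|n [ih1 ih2]] F.
  have -> : F = cst 0 by apply/funext => x; rewrite /F /series /= big_geq // mulr0.
  split; first by apply: eq_integrable (integrable0 _ _) => //.
  by rewrite /series /= big_geq // /Rintegral integral0.
pose G x := beta_integrand p (a - 1) x * series (fun k => c k * (1 - x) ^+ k) n.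
pose H x := c n * beta_integrand p (a - 1 + n%:R) x.
have n0 : (0 : R) <= n%:R by exact: ler0n.
have iH : mu.-integrable `](0 : R), 1[ (EFin \o H).
  by apply: integrable_scale => //; apply: integrable_beta; lra.
have FGH : {in `](0 : R), 1[%classic, F =1 (fun x => G x + H x)}.
  move=> x /set_mem /=; rewrite in_itv/= => /andP[_ x1].
  by rewrite /F /G /H -beta_integrand_shift // /series /= big_nat_recr //=; ring.
split.
  apply: eq_integrable (integrable_add _ ih1 iH) => //.
  by move=> x xD /=; rewrite FGH.
transitivity (\int[mu]_(x in `]0, 1[) (G x + H x)); first exact: eq_Rintegral.
rewrite RintegralD // ih2 /H RintegralZl //; last first.
  by apply: integrable_beta; lra.
by rewrite /series /= big_nat_recr.
Qed.

(** Dominated convergence for the partial sums; the series of absolute values is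
    an integrable bound. *)
Lemma series_kernel_moment (R : realType) (p a : R) (c : R^nat) :
  -1 < p -> 0 < a ->
  cvgn (series (fun k => `|c k| * beta_int p (a - 1 + k%:R))) ->
  mu.-integrable `]0, 1[ (EFin \o (fun x => series_kernel a c x * x `^ p)) /\
  \int[mu]_(x in `]0, 1[) (series_kernel a c x * x `^ p) =
  limn (series (fun k => c k * beta_int p (a - 1 + k%:R))).
Proof.
move=> p1 a0 cv.
pose F n x := beta_integrand p (a - 1) x * series (fun k => c k * (1 - x) ^+ k) n.
pose G n x := beta_integrand p (a - 1) x * series (fun k => `|c k| * (1 - x) ^+ k) n.
pose g x := beta_integrand p (a - 1) x * limn (series (fun k => `|c k| * (1 - x) ^+ k)).
pose f x := series_kernel a c x * x `^ p.
have cvx (x : R) : 0 < x -> x < 1 -> cvgn (series (fun k => `|c k| * (1 - x) ^+ k)).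
  move=> x0 x1; have h := power_series_abs_cvg p1 a0 x0 x1 cv.
  rewrite (_ : series _ = series (fun k => `|c k * (1 - x) ^+ k|)) //.
  congr series; apply/funext => k; rewrite normrM [in RHS](ger0_norm (x := _ ^+ k)) //.
  by rewrite exprn_ge0 // subr_ge0 ltW.
have G0 n x : x < 1 -> 0 <= G n x.
  move=> x1; rewrite mulr_ge0 ?beta_integrand_ge0 //.
  by apply: sumr_ge0 => k _; rewrite mulr_ge0 ?exprn_ge0 // subr_ge0 ltW.
have Gmono x : x < 1 -> {homo G ^~ x : n m / (n <= m)%N >-> n <= m}.
  move=> x1; apply/nondecreasing_seqP => n; rewrite ler_wpM2l ?beta_integrand_ge0//.
  by rewrite /series /= big_nat_recr //= lerDl mulr_ge0 // exprn_ge0 // subr_ge0 ltW.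
have Gg (x : R) : 0 < x -> x < 1 -> G n x @[n --> \oo] --> g x.
  by move=> x0 x1; apply: cvgMr; exact: cvx.
have Ff (x : R) : 0 < x -> x < 1 -> F n x @[n --> \oo] --> f x.
  move=> x0 x1; rewrite /f /series_kernel mulrC mulrA.
  by apply: cvgMr; exact: power_series_cvg cv.
have mF n : measurable_fun `](0 : R), 1[ (F n).
  by apply: measurable_funM; [exact: measurable_beta_integrand|exact: measurable_power_partial].
have mG n : measurable_fun `](0 : R), 1[ (G n).
  by apply: measurable_funM; [exact: measurable_beta_integrand|exact: measurable_power_partial].
have mg : measurable_fun `](0 : R), 1[ g.
  apply: (measurable_fun_cvg (h := G)) => //.
  by move=> x /=; rewrite in_itv/= => /andP[x0 x1]; exact: Gg.
have mf : measurable_fun `](0 : R), 1[ f.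
  apply: (measurable_fun_cvg (h := F)) => //.
  by move=> x /=; rewrite in_itv/= => /andP[x0 x1]; exact: Ff.
have g0 (x : R) : 0 < x -> x < 1 -> 0 <= g x.
  move=> x0 x1; rewrite -(cvg_lim _ (Gg _ x0 x1)) //; apply: limr_ge.
    by apply/cvg_ex; exists (g x); exact: Gg.
  by apply: nearW => n; exact: G0.
(* Monotone convergence: the integral of g is the sum of the absolute moments,
   finite by hypothesis. *)
have ig : mu.-integrable `](0 : R), 1[ (EFin \o g).
  apply/integrableP; split; first exact/measurable_EFinP.
  have -> : (\int[mu]_(x in `]0%R, 1%R[) `|(EFin \o g) x| =
      \int[mu]_(x in `]0%R, 1%R[) limn (fun n => (G n x)%:E))%E.
    apply: eq_integral => x /set_mem /=; rewrite in_itv/= => /andP[x0 x1].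
    rewrite ger0_norm ?g0 //; apply/esym/cvg_lim => //.
    by apply: cvg_EFin; [exact: nearW|exact: Gg].
  have mEG n : measurable_fun `](0 : R), 1[ (EFin \o G n) by exact/measurable_EFinP.
  rewrite monotone_convergence //; last 2 first.
  - by move=> n x /=; rewrite in_itv/= => /andP[_ x1]; rewrite lee_fin G0.
  - move=> x /=; rewrite in_itv/= => /andP[_ x1] n m nm.
    by rewrite lee_fin; exact: Gmono.
  have EG n : (\int[mu]_(x in `]0%R, 1%R[) (G n x)%:E =
      (series (fun k => `|c k| * beta_int p (a - 1 + k%:R)) n)%:E)%E.
    have [iG <-] := integral_power_partial (fun k => `|c k|) n p1 a0.
    by rewrite /Rintegral fineK //; exact: integrable_fin_num.
  under eq_fun do rewrite EG.
  rewrite (cvg_lim _ (cvg_EFin _ cv)) ?ltry //.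
  exact: nearW.
have [] := @dominated_convergence _ _ R mu `]0, 1[ (measurable_itv _)
  (fun n => EFin \o F n) (EFin \o f) (EFin \o g).
- by move=> n; apply/measurable_EFinP; exact: mF.
- exact/measurable_EFinP.
- apply: aeW => x /=; rewrite in_itv/= => /andP[x0 x1].
  by apply: cvg_EFin; [exact: nearW|exact: Ff].
- exact: ig.
- apply: aeW => x n /=; rewrite in_itv/= => /andP[x0 x1]; rewrite lee_fin.
  apply: (@le_trans _ _ (G n x)); last first.
    rewrite -(cvg_lim _ (Gg _ x0 x1)) //; apply: nondecreasing_cvgn_le; first exact: Gmono.
    by apply/cvg_ex; exists (g x); exact: Gg.
  rewrite /F normrM ger0_norm ?beta_integrand_ge0 // ler_wpM2l ?beta_integrand_ge0 //.
  apply: (le_trans (ler_norm_sum _ _ _)); apply: ler_sum => k _.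
  by rewrite normrM (ger0_norm (x := _ ^+ k)) ?exprn_ge0 // subr_ge0 ltW.
move=> if_ _ h; split => //.
have ff : (\int[mu]_(x in `]0%R, 1%R[) (EFin \o f) x)%E \is a fin_num.
  exact: integrable_fin_num.
have h2 : series (fun k => c k * beta_int p (a - 1 + k%:R)) n @[n --> \oo] -->
    \int[mu]_(x in `]0, 1[) f x.
  move: h; rewrite -(fineK ff) => /fine_cvgP[_]; apply: cvg_trans.
  apply: near_eq_cvg; apply: nearW => n /=.
  by have [_ <-] := integral_power_partial c n p1 a0.
by rewrite -(cvg_lim _ h2).
Qed.

(** The Beta integral trades the rising factorial of r for that of p + 1 + r:
    termwise integration of a Gauss series against a power is a Gauss series at
    argument 1. *)
Lemma gauss_term_beta (R : realType) (A B r p : R) (k : nat) : 0 < r -> -1 < p ->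
  gauss_term A B r k * beta_int p (r - 1 + k%:R) =
  gauss_term A B (p + 1 + r) k * beta_int p (r - 1).
Proof.
move=> r0 p1; rewrite beta_int_rising //; last lra.
rewrite subrK (_ : p + (r - 1) + 2 = p + 1 + r); last by ring.
rewrite /gauss_term.
have h1 : rising r k != 0 by rewrite gt_eqF // rising_gt0.
have h2 : rising (p + 1 + r) k != 0 by rewrite gt_eqF // rising_gt0 //; lra.
have h3 : k`!%:R != 0 :> R by rewrite pnatr_eq0 -lt0n fact_gt0.
by field; rewrite h1 h2 h3.
Qed.

Lemma series_kernel_hyp2F1 (R : realType) (A B r x : R) :
  series_kernel r (gauss_term A B r) x = (1 - x) `^ (r - 1) * hyp2F1 A B r (1 - x).
Proof.
rewrite /series_kernel /hyp2F1.
have -> // : (fun k => gauss_term A B r k * (1 - x) ^+ k) =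
  (fun k => rising A k * rising B k / rising r k * ((1 - x) ^+ k / k`!%:R)).
by apply/funext => k; rewrite /gauss_term mulrA mulrAC.
Qed.

(** Integrability against x^p is what an integral operator with kernel k needs to
    act on functions that are O(t^p) at 0. *)
Definition good_kernel (R : realType) (k : R -> R) (p : R) : Prop :=
  measurable_fun `](0 : R), 1[ k /\
  mu.-integrable `]0, 1[ (EFin \o (fun x => k x * x `^ p)).

(** The Mellin transform of k at p + 1, k being supported on ]0, 1[. *)
Definition moment (R : realType) (k : R -> R) (p : R) : R :=
  \int[mu]_(x in `]0, 1[) (k x * x `^ p).

Lemma hyp_kernel_moment (R : realType) (A B r p : R) : 0 < r -> -1 < p ->
  A + B - r - 1 < p ->
  good_kernel (series_kernel r (gauss_term A B r)) p /\
  moment (series_kernel r (gauss_term A B r)) p =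
  beta_int p (r - 1) * gauss_sum A B (p + 1 + r).
Proof.
move=> r0 p1 p2.
have C0 : 0 < p + 1 + r by lra.
have D0 : 0 < p + 1 + r - A - B by lra.
have cv : cvgn (series (fun k => `|gauss_term A B r k| * beta_int p (r - 1 + k%:R))).
  have -> : (fun k => `|gauss_term A B r k| * beta_int p (r - 1 + k%:R)) =
      beta_int p (r - 1) *: (fun k => `|gauss_term A B (p + 1 + r) k|).
    apply/funext => k.
    suff : `|gauss_term A B r k| * beta_int p (r - 1 + k%:R) =
      beta_int p (r - 1) * `|gauss_term A B (p + 1 + r) k| by [].
    rewrite -{1}[beta_int p (r - 1 + _)]ger0_norm ?beta_int_ge0 // -normrM.
    by rewrite gauss_term_beta // normrM mulrC ger0_norm ?beta_int_ge0.
  by apply: is_cvg_seriesZ; exact: gauss_abs_cvg.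
have [h1 h2] := series_kernel_moment p1 r0 cv.
split; first by split => //; exact: measurable_series_kernel cv.
rewrite /moment h2.
have -> : (fun k => gauss_term A B r k * beta_int p (r - 1 + k%:R)) =
    beta_int p (r - 1) *: gauss_term A B (p + 1 + r).
  by apply/funext => k; rewrite gauss_term_beta // mulrC.
by rewrite lim_seriesZ //; exact: gauss_cvg.
Qed.

(** The Taylor coefficients at 0 of the derivative of 2F1(A, B; 1; z). *)
Definition order0_coef (R : realType) (A B : R) : R^nat :=
  fun k => rising A k.+1 * rising B k.+1 / k.+1`!%:R / k`!%:R.

Lemma rising1_fact (R : realType) (k : nat) : rising (1 : R) k = k`!%:R.
Proof.
by elim: k => [|k ih]; rewrite ?rising0 // risingS ih factS mulnC natrM -natr1 addrC.
Qed.

Lemma order0_coef_beta (R : realType) (A B p : R) (k : nat) : -1 < p ->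
  order0_coef A B k * beta_int p (1 - 1 + k%:R) = gauss_term A B (p + 1) k.+1.
Proof.
move=> p1; rewrite subrr beta_int_rising ?ltrN10 //.
rewrite add0r rising1_fact beta_int0 // /order0_coef /gauss_term.
rewrite addr0 (risingSl (p + 1)) (_ : p + 1 + 1 = p + 2); last by ring.
have h2 : rising (p + 2) k != 0 by rewrite gt_eqF // rising_gt0 //; lra.
have h3 : k`!%:R != 0 :> R by rewrite pnatr_eq0 -lt0n fact_gt0.
have h4 : k.+1`!%:R != 0 :> R by rewrite pnatr_eq0 -lt0n fact_gt0.
have h5 : p + 1 != 0 by rewrite gt_eqF //; lra.
move: (k.+1`!%:R : R) h4 => N h4.
by field; rewrite h2 h3 h4 h5.
Qed.

(** Integration against the power shifts the index of the Gauss series by one; the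
    missing term 1 is contributed by a unit atom of the kernel at x = 1. *)
Lemma order0_kernel_moment (R : realType) (A B p : R) : -1 < p ->
  A + B - 1 < p ->
  good_kernel (series_kernel 1 (order0_coef A B)) p /\
  1 + moment (series_kernel 1 (order0_coef A B)) p = gauss_sum A B (p + 1).
Proof.
move=> p1 p2.
have C0 : 0 < p + 1 by lra.
have D0 : 0 < p + 1 - A - B by lra.
have cv : cvgn (series (fun k => `|order0_coef A B k| * beta_int p (1 - 1 + k%:R))).
  have -> : (fun k => `|order0_coef A B k| * beta_int p (1 - 1 + k%:R)) =
      (fun k => `|gauss_term A B (p + 1) (k + 1)%N|).
    apply/funext => k.
    rewrite -{1}[beta_int p (1 - 1 + _)]ger0_norm ?beta_int_ge0 // -normrM.
    by rewrite order0_coef_beta // addn1.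
  by apply: (@is_cvg_series_shift R (fun k => `|gauss_term A B (p + 1) k|) 1); exact: gauss_abs_cvg.
have [h1 h2] := series_kernel_moment p1 ltr01 cv.
split; first by split => //; exact: measurable_series_kernel cv.
rewrite /moment h2.
have -> : (fun k => order0_coef A B k * beta_int p (1 - 1 + k%:R)) =
    (fun k => gauss_term A B (p + 1) k.+1).
  by apply/funext => k; rewrite order0_coef_beta.
have cS : series (fun k => gauss_term A B (p + 1) k.+1) n @[n --> \oo] -->
    gauss_sum A B (p + 1) - 1.
  have -> : series (fun k => gauss_term A B (p + 1) k.+1) =
     (fun n => series (gauss_term A B (p + 1)) n.+1 - 1).
    apply/funext => n; rewrite /series /= big_nat_recl //= gauss_term0.
    by rewrite [RHS]addrC addKr.
  apply: cvgB; last exact: cvg_cst.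
  by rewrite (cvg_shiftS (series _)); exact: gauss_cvg.
by rewrite (cvg_lim _ cS) // addrC subrK.
Qed.

Lemma good_kernel_weaken (R : realType) (k : R -> R) (p q : R) : p <= q ->
  good_kernel k p -> good_kernel k q.
Proof.
move=> pq [mk ik]; split => //.
apply: (@dominated_integrable R _ _ (fun x => `|k x * x `^ p|)) => //.
- by apply: measurable_funM => //; exact: measurable_powR_itv.
- move=> x /=; rewrite in_itv/= => /andP[x0 x1]; rewrite !normrM ler_wpM2l //.
  rewrite !ger0_norm ?powR_ge0 //; apply: ger_powR => //.
  by apply/andP; split => //; exact: ltW.
- exact: integrable_norm ik.
Qed.

(** The kernel of the (n+1)-fold Riemann-Liouville integral, after s = t x. *)
Definition rl_kernel (R : realType) (n : nat) (x : R) : R :=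
  (1 - x) `^ n%:R / n`!%:R.

Lemma rl_kernel_moment (R : realType) (m : nat) (p : R) : -1 < p ->
  good_kernel (@rl_kernel R m) p /\
  moment (@rl_kernel R m) p = (rising (p + 1) m.+1)^-1.
Proof.
move=> p1; set k := @rl_kernel R m.
have m0 : (0 : R) <= m%:R by exact: ler0n.
have E : (fun x => k x * x `^ p) = (fun x => m`!%:R^-1 * beta_integrand p m%:R x).
  by apply/funext => x; rewrite /k /rl_kernel /beta_integrand; ring.
have ib : mu.-integrable `](0 : R), 1[ (EFin \o beta_integrand p m%:R).
  by apply: integrable_beta => //; lra.
split.
  split.
    by apply: measurable_funM => //; exact: measurable_onem_powR.
  by rewrite E; apply: integrable_scale.
rewrite /moment E RintegralZl // -/(beta_int _ _).
rewrite -[m%:R]add0r beta_int_rising ?ltrN10 //.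
rewrite add0r rising1_fact beta_int0 // risingSl addr0.
rewrite (_ : p + 1 + 1 = p + 2); last by ring.
have h2 : rising (p + 2) m != 0 by rewrite gt_eqF // rising_gt0 //; lra.
have h3 : m`!%:R != 0 :> R by rewrite pnatr_eq0 -lt0n fact_gt0.
have h5 : p + 1 != 0 by rewrite gt_eqF //; lra.
by field; rewrite h2 h3 h5.
Qed.

(** * Operators of Mellin type *)

(** Up to the factor t^d, these are the operators that commute with dilations:
    integration of g (t x) against a kernel on ]0, 1[ together with an atom of
    mass k0 at x = 1, which is there for operators of order zero. They are
    diagonal on powers of t. *)
Definition mellin_op (R : realType) (k0 : R) (k : R -> R) (d : R) (g : R -> R)
    (t : R) : R :=
  t `^ d * (k0 * g t + \int[mu]_(x in `]0, 1[) (k x * g (t * x))).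

(** Continuous functions on ]0, +oo[ that are O(s^e) at 0. By continuity the bound
    extends to every ]0, T], and the least such M is the weighted sup norm in
    which the operators below are continuous. *)
Definition growth (R : realType) (e : R) (g : R -> R) : Prop :=
  (forall t, 0 < t -> {for t, continuous g}) /\
  (forall T, 0 < T ->
     exists2 M, 0 <= M & forall s, 0 < s -> s <= T -> `|g s| <= M * s `^ e).

Definition abs_moment (R : realType) (k : R -> R) (p : R) : R :=
  \int[mu]_(x in `]0, 1[) `|k x * x `^ p|.

Lemma abs_moment_ge0 (R : realType) (k : R -> R) (p : R) : 0 <= abs_moment k p.
Proof. exact: Rintegral_ge0. Qed.

Lemma continuous_scale_at (R : realType) (g : R -> R) (t x : R) :
  {for t * x, continuous g} -> {for t, continuous (fun s : R => g (s * x))}.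
Proof.
move=> cg; apply: (@cvg_comp _ _ _ (fun s : R => s * x) g (nbhs t) (nbhs (t * x))) => //.
by apply: cvgMl; exact: cvg_id.
Qed.

Lemma measurable_dilate (R : realType) (g : R -> R) (t : R) :
  (forall s, 0 < s -> {for s, continuous g}) -> 0 < t ->
  measurable_fun `](0 : R), 1[ (fun x => g (t * x)).
Proof.
move=> cg t0; apply: itv_oo_measurable_fun => x x0 _.
apply: (@cvg_comp _ _ _ (fun s : R => t * s) g (nbhs x) (nbhs (t * x))).
  by apply: cvgMr; exact: cvg_id.
by apply: cg; rewrite mulr_gt0.
Qed.

Lemma mellin_integrand_bound (R : realType) (k g : R -> R) (e t M x : R) :
  0 < t -> 0 < x -> x < 1 ->
  (forall s, 0 < s -> s <= t -> `|g s| <= M * s `^ e) ->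
  `|k x * g (t * x)| <= M * t `^ e * `|k x * x `^ e|.
Proof.
move=> t0 x0 x1 hg; rewrite !normrM.
have tx0 : 0 < t * x by rewrite mulr_gt0.
have txt : t * x <= t by rewrite ger_pMr // ltW.
apply: (le_trans (ler_wpM2l (normr_ge0 (k x)) (hg _ tx0 txt))).
rewrite powRM ?(ltW t0) ?(ltW x0) // (ger0_norm (powR_ge0 _ _)).
by rewrite le_eqVlt; apply/orP; left; apply/eqP; ring.
Qed.

Lemma integrable_mellin (R : realType) (k g : R -> R) (e t : R) :
  good_kernel k e -> growth e g -> 0 < t ->
  mu.-integrable `]0, 1[ (EFin \o (fun x => k x * g (t * x))).
Proof.
move=> [mk ik] [cg bg] t0; have [M M0 hM] := bg _ t0.
apply: (@dominated_integrable R _ _ (fun x => M * t `^ e * `|k x * x `^ e|)) => //.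
- by apply: measurable_funM => //; exact: measurable_dilate.
- move=> x /=; rewrite in_itv/= => /andP[x0 x1].
  exact: mellin_integrand_bound.
- by apply: integrable_scale => //; exact: integrable_norm ik.
Qed.

Lemma mellin_op_bound (R : realType) (k0 : R) (k g : R -> R) (d e t M : R) :
  good_kernel k e -> growth e g -> 0 < t ->
  (forall s, 0 < s -> s <= t -> `|g s| <= M * s `^ e) ->
  `|mellin_op k0 k d g t| <= M * (`|k0| + abs_moment k e) * t `^ (e + d).
Proof.
move=> gk gg t0 hM; have [mk ik] := gk; have [cg bg] := gg.
have ig := integrable_mellin gk gg t0.
rewrite /mellin_op normrM ger0_norm ?powR_ge0 // powRD; last first.
  by apply/implyP => _; rewrite gt_eqF.
have h1 : `|k0 * g t| <= `|k0| * (M * t `^ e).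
  by rewrite normrM ler_wpM2l // hM.
have h2 : `|\int[mu]_(x in `]0, 1[) (k x * g (t * x))| <= M * t `^ e * abs_moment k e.
  apply: (le_trans (le_normr_Rintegral _ ig)) => //.
  rewrite -RintegralZl //; last exact: integrable_norm ik.
  apply: le_Rintegral => //.
  - exact: integrable_norm ig.
  - by apply: integrable_scale => //; exact: integrable_norm ik.
  - move=> x /=; rewrite in_itv/= => /andP[x0 x1].
    exact: mellin_integrand_bound.
have h3 := le_trans (ler_normD _ _) (lerD h1 h2).
apply: (le_trans (ler_wpM2l (powR_ge0 t d) h3)).
by rewrite le_eqVlt; apply/orP; left; apply/eqP; ring.
Qed.

Lemma powR_le_ends (R : realType) (e u v s : R) : 0 < u -> u <= s -> s <= v ->
  s `^ e <= u `^ e + v `^ e.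
Proof.
move=> u0 us sv.
have [e0|e0] := leP 0 e.
  have : s `^ e <= v `^ e by apply: ge0_ler_powR; rewrite ?nnegrE; lra.
  by have := powR_ge0 u e; lra.
have h : u `^ (- e) <= s `^ (- e) by apply: ge0_ler_powR; rewrite ?nnegrE; lra.
have : s `^ e <= u `^ e.
  rewrite -[e]opprK [leLHS]powRN [leRHS]powRN lef_pV2 ?posrE ?powR_gt0//; lra.
by have := powR_ge0 v e; lra.
Qed.

(** For s in ]t/2, 2t[ the integrands have a common integrable bound, a multiple of
    |k x| x^e. *)
Lemma mellin_op_continuous (R : realType) (k0 : R) (k g : R -> R) (d e t : R) :
  good_kernel k e -> growth e g -> 0 < t ->
  {for t, continuous (mellin_op k0 k d g)}.
Proof.
move=> gk gg t0; have [mk ik] := gk; have [cg bg] := gg.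
apply: cvgM; first exact: powR_continuous.
apply: cvgD; first by apply: cvgMr; exact: cg.
have t20 : 0 < t * 2 by lra.
have [M M0 hM] := bg _ t20.
pose C := (t / 2) `^ e + (t * 2) `^ e.
pose G x := M * C * `|k x * x `^ e|.
have tI : t \in `]t / 2, t * 2[%classic by rewrite inE /= in_itv/=; apply/andP; split; lra.
apply: (@continuity_under_integral R _ _ mu (fun s x => k x * g (s * x)) `]0, 1[ _
  (t / 2) (t * 2) _ _ G) tI => //.
- move=> s /=; rewrite in_itv/= => /andP[s0 _]; apply: integrable_mellin gk gg _; lra.
- apply: aeW => x /=; rewrite in_itv/= => /andP[x0 x1] s /set_mem /=.
  rewrite in_itv/= => /andP[s0 _]; apply: cvgMr; apply: continuous_scale_at.
  by apply: cg; rewrite mulr_gt0 //; lra.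
- by apply: integrable_scale => //; exact: integrable_norm ik.
- move=> s /=; rewrite in_itv/= => /andP[s1 s2]; apply: aeW => x /=.
  rewrite in_itv/= => /andP[x0 x1].
  have s0 : 0 < s by lra.
  have hs u : 0 < u -> u <= s -> `|g u| <= M * u `^ e by move=> *; apply: hM; lra.
  apply: (le_trans (mellin_integrand_bound k s0 x0 x1 hs)).
  rewrite /G ler_wpM2r // ler_wpM2l //.
  by apply: powR_le_ends; lra.
Qed.

Lemma mellin_op_growth (R : realType) (k0 : R) (k g : R -> R) (d e : R) :
  good_kernel k e -> growth e g -> growth (e + d) (mellin_op k0 k d g).
Proof.
move=> gk gg; split; first by move=> t t0; exact: mellin_op_continuous gk gg t0.
move=> T T0; have [M M0 hM] := gg.2 _ T0.
exists (M * (`|k0| + abs_moment k e)).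
  by rewrite mulr_ge0 // addr_ge0 // abs_moment_ge0.
move=> s s0 sT; apply: mellin_op_bound => // u u0 us; apply: hM => //.
exact: le_trans us sT.
Qed.

Lemma growthB (R : realType) (e : R) (f g : R -> R) :
  growth e f -> growth e g -> growth e (fun x => f x - g x).
Proof.
move=> [cf bf] [cg bg]; split.
  by move=> t t0; apply: cvgB; [exact: cf|exact: cg].
move=> T T0; have [M M0 hM] := bf _ T0; have [N N0 hN] := bg _ T0.
exists (M + N); first exact: addr_ge0.
move=> s s0 sT; apply: (le_trans (ler_normB _ _)).
by rewrite mulrDl lerD ?hM ?hN.
Qed.

Lemma mellin_opB (R : realType) (k0 : R) (k f g : R -> R) (d e t : R) :
  good_kernel k e -> growth e f -> growth e g -> 0 < t ->
  mellin_op k0 k d (fun x => f x - g x) t =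
  mellin_op k0 k d f t - mellin_op k0 k d g t.
Proof.
move=> gk gf gg t0; rewrite /mellin_op.
have -> : \int[mu]_(x in `]0, 1[) (k x * (f (t * x) - g (t * x))) =
  \int[mu]_(x in `]0, 1[) (k x * f (t * x)) - \int[mu]_(x in `]0, 1[) (k x * g (t * x)).
  rewrite -RintegralB //; [|exact: integrable_mellin gk _ t0..].
  by apply: eq_Rintegral => x _; rewrite mulrBr.
by ring.
Qed.

(** Continuity in the weighted sup norm on ]0, t]: two such operators that agree on
    a dense set of functions are therefore equal. *)
Lemma mellin_op_lipschitz (R : realType) (k0 : R) (k f g : R -> R) (d e t delta : R) :
  good_kernel k e -> growth e f -> growth e g -> 0 < t ->
  (forall s, 0 < s -> s <= t -> `|f s - g s| <= delta * s `^ e) ->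
  `|mellin_op k0 k d f t - mellin_op k0 k d g t| <=
  delta * (`|k0| + abs_moment k e) * t `^ (e + d).
Proof.
move=> gk gf gg t0 h; rewrite -(mellin_opB _ _ gk gf gg t0).
by apply: mellin_op_bound => //; exact: growthB.
Qed.

Lemma eq_mellin_op (R : realType) (k0 : R) (k f g : R -> R) (d t : R) : 0 < t ->
  (forall s, 0 < s -> s <= t -> f s = g s) ->
  mellin_op k0 k d f t = mellin_op k0 k d g t.
Proof.
move=> t0 fg; rewrite /mellin_op fg //; congr (_ * (_ + _)).
apply: eq_Rintegral => x /set_mem /=; rewrite in_itv/= => /andP[x0 x1].
by rewrite fg ?mulr_gt0 // ger_pMr // ltW.
Qed.

Definition power_sum (R : realType) (e : R) (c : R^nat) (n : nat) (s : R) : R :=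
  \sum_(i < n) c i * s `^ (e + i%:R).

Lemma growth_weaken (R : realType) (e e' : R) (g : R -> R) : e <= e' ->
  growth e' g -> growth e g.
Proof.
move=> ee [cg bg]; split => // T T0; have [M M0 hM] := bg _ T0.
exists (M * T `^ (e' - e)); first by rewrite mulr_ge0 ?powR_ge0.
move=> s s0 sT; apply: (le_trans (hM _ s0 sT)); rewrite -mulrA ler_wpM2l //.
have -> : e' = (e' - e) + e by lra.
rewrite powRD; last by apply/implyP => _; rewrite gt_eqF.
rewrite ler_wpM2r ?powR_ge0 // addrK.
by apply: ge0_ler_powR; rewrite ?nnegrE; lra.
Qed.

Lemma growth_powR (R : realType) (e : R) : growth e (fun s => s `^ e).
Proof.
split; first by move=> t t0; exact: powR_continuous.
by move=> T T0; exists 1 => // s s0 sT; rewrite mul1r ger0_norm ?powR_ge0.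
Qed.

Lemma growth_scale (R : realType) (e c : R) (f : R -> R) :
  growth e f -> growth e (fun x => c * f x).
Proof.
move=> [cf bf]; split; first by move=> t t0; apply: cvgMr; exact: cf.
move=> T T0; have [M M0 hM] := bf _ T0; exists (`|c| * M); first exact: mulr_ge0.
by move=> s s0 sT; rewrite normrM -mulrA ler_wpM2l ?hM.
Qed.

Lemma power_sumS (R : realType) (e : R) (c : R^nat) (n : nat) :
  power_sum e c n.+1 = (fun s => power_sum e c n s - (- c n) * s `^ (e + n%:R)).
Proof. by apply/funext => s; rewrite /power_sum big_ord_recr /= mulNr opprK. Qed.

Lemma growth_power_sum (R : realType) (e : R) (c : R^nat) (n : nat) :
  growth e (power_sum e c n).
Proof.
elim: n => [|n ih].
  have -> : power_sum e c 0 = (fun x => 0 * (x `^ e)).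
    by apply/funext => x; rewrite /power_sum big_ord0 mul0r.
  by apply: growth_scale; exact: growth_powR.
rewrite power_sumS; apply: growthB => //; apply: growth_scale.
by apply: (growth_weaken _ (growth_powR _)); rewrite lerDl.
Qed.

Lemma mellin_op_powR (R : realType) (k0 c : R) (k : R -> R) (d p t : R) :
  good_kernel k p -> 0 < t ->
  mellin_op k0 k d (fun s => c * s `^ p) t = c * (k0 + moment k p) * t `^ (p + d).
Proof.
move=> [mk ik] t0; rewrite /mellin_op.
have -> : \int[mu]_(x in `]0, 1[) (k x * (c * (t * x) `^ p)) = c * t `^ p * moment k p.
  transitivity (\int[mu]_(x in `]0, 1[) (c * t `^ p * (k x * x `^ p))).
    apply: eq_Rintegral => x /set_mem /=; rewrite in_itv/= => /andP[x0 _].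
    by rewrite powRM ?(ltW t0) ?(ltW x0) //; ring.
  exact: Rintegral_scale ik.
rewrite powRD; last by apply/implyP => _; rewrite gt_eqF.
by ring.
Qed.

Lemma mellin_op_power_sum (R : realType) (k0 : R) (k : R -> R) (d e t : R)
    (c : R^nat) (n : nat) :
  good_kernel k e -> 0 < t ->
  mellin_op k0 k d (power_sum e c n) t =
  power_sum (e + d) (fun i => c i * (k0 + moment k (e + i%:R))) n t.
Proof.
move=> gk t0; elim: n => [|n ih].
  have -> : power_sum e c 0 = (fun x => 0 * (x `^ e)).
    by apply/funext => x; rewrite /power_sum big_ord0 mul0r.
  by rewrite mellin_op_powR // !mul0r /power_sum big_ord0.
have gn : growth e (fun s : R => - c n * s `^ (e + n%:R)).
  apply: growth_scale; apply: (growth_weaken _ (growth_powR _)).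
  by rewrite lerDl.
rewrite power_sumS (mellin_opB _ _ gk) //; last exact: growth_power_sum.
rewrite ih mellin_op_powR //; last first.
  by apply: good_kernel_weaken gk; rewrite lerDl.
rewrite [RHS]/power_sum big_ord_recr /= -/(power_sum _ _ _ _).
by rewrite !mulNr opprK [e + d + _]addrAC.
Qed.

(** * Polynomial approximation *)

Lemma segment_uniform_continuity (R : realType) (h : R -> R) (a b delta : R) :
  continuous h -> 0 < delta ->
  exists2 eta : R, 0 < eta & forall x y, a <= x <= b ->
    `|x - y| < eta -> `|h x - h y| <= delta.
Proof.
move=> ch d0.
have d20 : 0 < delta / 2 by lra.
have /compact_near_coveringP cov := @segment_compact R a b.
have [|e /= e0 he] := cov R (0^'+)
  (fun eta x => forall y, `|x - y| < eta -> `|h x - h y| <= delta) _.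
  move=> x _; have /cvgrPdist_lt /(_ _ d20) := ch x.
  move=> /nbhs_ballP[r /= r0 hr].
  exists (ball x (r / 2), [set eta | eta < r / 2]).
    split; first by exists (r / 2) => //=; lra.
    by exists (r / 2) => /=; [lra|move=> z /= + z0; rewrite sub0r normrN gtr0_norm].
  move=> [x' eta] /= [xx' er] y xy.
  have h1 : `|h x - h x'| < delta / 2.
    by apply: hr; apply: le_ball xx'; lra.
  have h2 : `|h x - h y| < delta / 2.
    apply: hr; rewrite /ball /= in xx' *.
    have := ler_distD x' x y; lra.
  by have := ler_distD (h x) (h x') (h y); rewrite distrC in h1; lra.
exists (e / 2); first lra.
move=> x y xab xy.
by apply: (he (e / 2)) => //=; [rewrite sub0r normrN gtr0_norm; lra|lra].
Qed.

(** The value at x of the Bernstein polynomial with coefficients phi 0, ..., phi n,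
    by de Casteljau's recursion. In this form positivity and the moments of the
    binomial law are immediate inductions, without binomial coefficients. *)
Fixpoint bernstein (R : comNzRingType) (n : nat) (phi : nat -> R) (x : R) : R :=
  if n is n'.+1 then
    x * bernstein n' (fun j => phi j.+1) x + (1 - x) * bernstein n' phi x
  else phi 0%N.

Fixpoint bernstein_poly (R : comNzRingType) (n : nat) (phi : nat -> R) : {poly R} :=
  if n is n'.+1 then
    'X * bernstein_poly n' (fun j => phi j.+1) + (1 - 'X) * bernstein_poly n' phi
  else (phi 0%N)%:P.

Lemma horner_bernstein (R : comNzRingType) (n : nat) (phi : nat -> R) (x : R) :
  (bernstein_poly n phi).[x] = bernstein n phi x.
Proof. by elim: n phi => [|n ih] phi /=; rewrite !hornerE // !ih. Qed.

Lemma bernstein_le (R : realType) (n : nat) (phi psi : nat -> R) (x : R) :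
  0 <= x <= 1 -> (forall j, (j <= n)%N -> phi j <= psi j) ->
  bernstein n phi x <= bernstein n psi x.
Proof.
move=> /andP[x0 x1]; elim: n phi psi => [|n ih] phi psi h /=; first exact: h.
apply: lerD; apply: ler_wpM2l; rewrite ?subr_ge0 //; apply: ih => j jn; apply: h => //.
exact: leq_trans jn _.
Qed.

Lemma bernstein_affine (R : comNzRingType) (n : nat) (a b : R) (phi : nat -> R) (x : R) :
  bernstein n (fun j => a + b * phi j) x = a + b * bernstein n phi x.
Proof. by elim: n phi => [|n ih] phi //=; rewrite (ih (fun j => phi j.+1)) ih; ring. Qed.

Lemma bernstein_variance (R : comNzRingType) (n : nat) (c x : R) :
  bernstein n (fun j => (j%:R - c) ^+ 2) x = n%:R * x * (1 - x) + (n%:R * x - c) ^+ 2.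
Proof.
elim: n c => [|n ih] c /=; first by ring.
have -> : bernstein n (fun j => (j.+1%:R - c) ^+ 2) x =
    bernstein n (fun j => (j%:R - (c - 1)) ^+ 2) x.
  by congr bernstein; apply/funext => j; rewrite -natr1; ring.
by rewrite !ih -natr1; ring.
Qed.

(** Bernstein's proof. Uniform continuity bounds h x - h y by delta / 2 plus a
    multiple of (x - y)^2, and averaging over y = j / n turns the square into a
    variance of order 1 / n. *)
Lemma weierstrass (R : realType) (h : R -> R) (delta : R) :
  continuous h -> 0 < delta ->
  exists P : {poly R}, forall x, 0 <= x <= 1 -> `|h x - P.[x]| <= delta.
Proof.
move=> ch d0.
have d20 : 0 < delta / 2 by lra.
have [eta eta0 heta] := @segment_uniform_continuity R h 0 1 _ ch d20.
have [M hM] : exists M : R, forall x : R, 0 <= x <= 1 -> `|h x| <= M.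
  have cn : {within `[(0 : R), 1], continuous (fun x => `|h x|)}.
    by apply: continuous_subspaceT => x; apply: cvg_norm; exact: ch.
  have [c _ hc] := EVT_max (@ler01 R) cn.
  by exists `|h c| => x x01; apply: hc; rewrite in_itv.
have M0 : 0 <= M by rewrite (le_trans (normr_ge0 _) (hM 0 _)) // lexx ler01.
(* K pays for the pairs at distance at least eta, where (x - y) ^+ 2 is at
   least eta ^+ 2 and the oscillation is at most 2 * M. *)
pose K : R := 2 * M / eta ^+ 2.
have K0 : 0 <= K by rewrite divr_ge0 ?mulr_ge0 ?exprn_ge0 ?(ltW eta0).
have quad (x y : R) : 0 <= x <= 1 -> 0 <= y <= 1 -> 
    `|h x - h y| <= delta / 2 + K * (x - y) ^+ 2.
  move=> x01 y01; have [xy|xy] := ltP `|x - y| eta.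
    apply: (le_trans (heta _ _ x01 xy)); rewrite lerDl.
    by rewrite mulr_ge0 // sqr_ge0.
  have h1 : `|h x - h y| <= 2 * M.
    by apply: (le_trans (ler_normB _ _)); have := hM _ x01; have := hM _ y01; lra.
  apply: (le_trans h1); apply: ler_wpDl; first exact: ltW.
  rewrite /K mulrAC ler_pdivlMr ?exprn_gt0 // ler_wpM2l ?mulr_ge0 //.
  by rewrite -[leRHS]real_normK ?num_real // lerXn2r ?nnegrE // ltW.
near \oo => n0.
pose n := n0.+1.
have n0' : 0 < n%:R :> R by rewrite ltr0n.
exists (bernstein_poly n (fun j => h (j%:R / n%:R))) => x x01.
rewrite horner_bernstein.
have bnd j : (j <= n)%N -> `|h x - h (j%:R / n%:R)| <=
    delta / 2 + K / n%:R ^+ 2 * (j%:R - n%:R * x) ^+ 2.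
  move=> jn; apply: (le_trans (quad _ (j%:R / n%:R) x01 _)).
    by rewrite divr_ge0 //= ler_pdivrMr // mul1r ler_nat.
  rewrite lerD2l -mulrA ler_wpM2l // le_eqVlt; apply/orP; left; apply/eqP.
  by move: (n%:R : R) n0' => N N0; field; rewrite gt_eqF.
(* V is the Bernstein average of these bounds: the quadratic part averages to
   the variance of a binomial law, of order n. *)
pose V : R := delta / 2 + K / n%:R ^+ 2 * (n%:R * x * (1 - x)).
have hV : bernstein n (fun j => delta / 2 + K / n%:R ^+ 2 * (j%:R - n%:R * x) ^+ 2) x = V.
  by rewrite bernstein_affine bernstein_variance subrr expr0n addr0.
have Vd : V <= delta.
  have Kn : K / (delta / 2) <= n%:R.
    by rewrite /n -natr1; have : K / (delta / 2) <= n0%:R by [near: n0; exact: nbhs_infty_ger]; lra.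
  rewrite ler_pdivrMr // in Kn.
  have x11 : x * (1 - x) <= 1 by move: x01 => /andP[? ?]; nra.
  have : K / n%:R ^+ 2 * (n%:R * x * (1 - x)) <= delta / 2.
    have -> : K / n%:R ^+ 2 * (n%:R * x * (1 - x)) = K / n%:R * (x * (1 - x)).
      by move: (n%:R : R) n0' => N N0; field; rewrite gt_eqF.
    apply: (@le_trans _ _ (K / n%:R)).
      by rewrite ler_piMr // divr_ge0 // ltW.
    by rewrite ler_pdivrMr // mulrC.
  rewrite /V; lra.
pose D j := delta / 2 + K / n%:R ^+ 2 * (j%:R - n%:R * x) ^+ 2.
have lo : bernstein n (fun j => h x + (-1) * D j) x <=
    bernstein n (fun j => h (j%:R / n%:R)) x.
  apply: bernstein_le => // j /bnd; rewrite -/(D j) ler_distl => /andP[? ?]; lra.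
have hi : bernstein n (fun j => h (j%:R / n%:R)) x <=
    bernstein n (fun j => h x + 1 * D j) x.
  apply: bernstein_le => // j /bnd; rewrite -/(D j) ler_distl => /andP[? ?]; lra.
have hD : bernstein n D x = V by exact: hV.
rewrite (bernstein_affine n (h x) (-1) D) hD in lo.
rewrite (bernstein_affine n (h x) 1 D) hD in hi.
by rewrite ler_distl; apply/andP; split; lra.
Unshelve. all: by end_near. Qed.

(** * Density of power sums *)

(** The strict inequality e < e' makes g x * x^(-e) tend to 0 at 0, so the weighted
    function extends continuously by 0. *)
Lemma weighted_extension_continuous (R : realType) (g : R -> R) (e e' : R) :
  growth e' g -> e < e' ->
  continuous (fun x : R => if x <= 0 then 0 else g x * x `^ (- e)).
Proof.
move=> [cg bg] ee x; have [x0|x0|->] := ltgtP x 0.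
- rewrite /continuous_at ltW //; apply: cvg_near_cst.
  near=> y; rewrite ifT // ltW //; near: y; exact: lt_nbhsl.
- rewrite /continuous_at leNgt x0 /=.
  have h : g y * y `^ (- e) @[y --> x] --> g x * x `^ (- e).
    by apply: cvgM; [exact: cg|exact: powR_continuous].
  apply: cvg_trans h; apply: near_eq_cvg; near=> y.
  by rewrite leNgt ifF //; apply/negbTE; rewrite negbK; near: y; exact: lt_nbhsr.
- rewrite /continuous_at lexx; apply/cvgr0Pnorm_le => eta eta0.
  have [M M0 hM] := bg _ ltr01.
  have r0 : 0 < e' - e by lra.
  have c0 : M * y `^ (e' - e) @[y --> 0^'+] --> (0 : R).
    by rewrite -[X in _ --> X](mulr0 M); apply: cvgMr; exact: powR_cvg0.
  have [rho /= rho0 hrho] : \forall y \near (0 : R)^'+, M * y `^ (e' - e) <= eta.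
    exact: (cvgr_le _ c0).
  near=> y; case: ifPn => [_|]; first by rewrite normr0 ltW.
  rewrite -ltNge => y0.
  have y1 : y <= 1.
    have : y < 1 by near: y; exact: lt_nbhsl.
    exact: ltW.
  apply: (@le_trans _ _ (M * y `^ (e' - e))).
    rewrite normrM (ger0_norm (powR_ge0 _ _)) powRD; last by apply/implyP; rewrite gt_eqF.
    by rewrite mulrA ler_wpM2r ?powR_ge0 // hM.
  by apply: hrho => //=; rewrite sub0r normrN gtr0_norm.
Unshelve. all: by end_near. Qed.

(** Weierstrass's theorem for the continuous extension of g s * s^(-e), rescaled
    from [0, T] to [0, 1]. *)
Lemma growth_power_approx (R : realType) (g : R -> R) (e e' T delta : R) :
  growth e' g -> e < e' -> 0 < T -> 0 < delta ->
  exists c : R^nat, exists n : nat, forall s, 0 < s -> s <= T ->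
    `|g s - power_sum e c n s| <= delta * s `^ e.
Proof.
move=> gg ee T0 d0.
pose h (x : R) := if x <= 0 then 0 else g x * x `^ (- e).
have ch : continuous h by exact: weighted_extension_continuous gg ee.
have chT : continuous (fun x => h (T * x)).
  move=> x; apply: (@cvg_comp _ _ _ (fun s : R => T * s) h (nbhs x) (nbhs (T * x))).
    by apply: cvgMr; exact: cvg_id.
  exact: ch.
have [P hP] := weierstrass chT d0.
exists (fun i => P`_i * T ^- i), (size P) => s s0 sT.
have sT01 : 0 <= s / T <= 1.
  by rewrite divr_ge0 ?(ltW s0) ?(ltW T0) //= ler_pdivrMr // mul1r.
have sE : T * (s / T) = s by rewrite mulrC divfK // gt_eqF.
have := hP _ sT01; rewrite sE /h (leNgt s) s0 /= => h1.
have E : power_sum e (fun i => P`_i * T ^- i) (size P) s = P.[s / T] * s `^ e.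
  rewrite /power_sum horner_coef mulr_suml; apply: eq_bigr => i _.
  rewrite powRD; last by apply/implyP => _; rewrite gt_eqF.
  by rewrite powR_mulrn ?ltW // expr_div_n; ring.
have s1 : s `^ (- e) * s `^ e = 1.
  by rewrite powRN mulVf // gt_eqF // powR_gt0.
have -> : g s - power_sum e (fun i => P`_i * T ^- i) (size P) s =
    (g s * s `^ (- e) - P.[s / T]) * s `^ e.
  by rewrite E mulrBl -mulrA s1 mulr1.
by rewrite normrM (ger0_norm (powR_ge0 _ _)) ler_wpM2r ?powR_ge0.
Qed.

(** The form in which density is used: the functionals are compared on g and on a
    power sum f close to g in the weighted sup norm. *)
Lemma growth_density (R : realType) (L1 L2 : (R -> R) -> R) (g : R -> R)
    (e e' T C : R) :
  growth e' g -> e < e' -> 0 < T -> 0 <= C ->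
  (forall c n, L1 (power_sum e c n) = L2 (power_sum e c n)) ->
  (forall f delta, growth e f -> 0 < delta ->
    (forall s, 0 < s -> s <= T -> `|g s - f s| <= delta * s `^ e) ->
    `|L1 g - L1 f| <= C * delta /\ `|L2 g - L2 f| <= C * delta) ->
  L1 g = L2 g.
Proof.
move=> gg ee T0 C0 agree lip; apply/eqP; rewrite -subr_eq0 -normr_le0.
apply/ler_addgt0Pr => eta eta0; rewrite add0r.
pose delta := eta / (2 * C + 1).
have C1 : 0 < 2 * C + 1 by lra.
have d0 : 0 < delta by rewrite divr_gt0.
have [c [n hcn]] := growth_power_approx gg ee T0 d0.
have [l1 l2] := lip _ _ (growth_power_sum e c n) d0 hcn.
have -> : L1 g - L2 g = (L1 g - L1 (power_sum e c n)) - (L2 g - L2 (power_sum e c n)).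
  by rewrite agree; ring.
apply: (le_trans (ler_normB _ _)).
have E : (2 * C + 1) * delta = eta by rewrite mulrC divfK // gt_eqF.
nra.
Qed.

(** * Saigo operators of positive order *)

(** At order zero, 2F1(b, -c; 1; z) replaces the Gauss function of positive order:
    its derivative is the regular part of the limit of the kernels as a tends to
    0, while the constant term concentrates at x = 1 as an atom. *)
Definition saigo_kernel (R : realType) (a b c : R) : R -> R :=
  if a == 0 then series_kernel 1 (order0_coef b (- c))
  else fun x => (gamma_fun a)^-1 * series_kernel a (gauss_term (a + b) (- c) a) x.

Definition saigo_atom (R : realType) (a : R) : R := (a == 0)%:R.

Lemma saigo_kernel_moment (R : realType) (a b c p : R) :
  0 <= a -> -1 < p -> b - c - 1 < p ->
  good_kernel (saigo_kernel a b c) p /\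
  saigo_atom a + moment (saigo_kernel a b c) p = saigo_mult a b c p.
Proof.
move=> a0 p1 p2; rewrite /saigo_kernel /saigo_atom /saigo_mult /beta_mult.
case: eqVneq => [->|an0].
  rewrite mul1r add0r addr0; apply: order0_kernel_moment => //; lra.
have ap : 0 < a by rewrite lt_neqAle eq_sym an0.
have [[mk ik] hm] : good_kernel (series_kernel a (gauss_term (a + b) (- c) a)) p /\
    moment (series_kernel a (gauss_term (a + b) (- c) a)) p =
    beta_int p (a - 1) * gauss_sum (a + b) (- c) (p + 1 + a).
  by apply: hyp_kernel_moment => //; lra.
have E : (fun x => (gamma_fun a)^-1 * series_kernel a (gauss_term (a + b) (- c) a) x * x `^ p) =
    (fun x => (gamma_fun a)^-1 * (series_kernel a (gauss_term (a + b) (- c) a) x * x `^ p)).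
  by apply/funext => x; rewrite -[LHS]mulrA.
split.
  split; first exact: measurable_funM.
  by rewrite E; apply: integrable_scale.
by rewrite add0r /moment E (Rintegral_scale _ _ ik) // -/(moment _ _) hm; ring.
Qed.

(** The substitution s = t x. *)
Lemma saigo_pos_mellin (R : realType) (a b c e t : R) (g : R -> R) :
  0 < a -> -1 < e -> b - c - 1 < e -> growth e g -> 0 < t ->
  saigo_pos a b c g t = mellin_op 0 (saigo_kernel a b c) (- b) g t.
Proof.
move=> a0 e1 e2 gg t0.
rewrite /saigo_kernel ifF; last by apply/negbTE; rewrite gt_eqF.
pose K := series_kernel a (gauss_term (a + b) (- c) a).
have gK : good_kernel K e.
  have e3 : a + b + - c - a - 1 < e by lra.
  by have [] := hyp_kernel_moment a0 e1 e3.
have iK := integrable_mellin gK gg t0.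
have tn0 : t != 0 by rewrite gt_eqF.
have E1 : (fun x : R => t * x + 0) @^-1` `]0, t[ = `](0 : R), 1[%classic.
  by rewrite preimage_affine_itv // subrr mul0r subr0 divff.
have E2 : (fun x : R => t^-1 * x + 0) @^-1` `]0, 1[ = `](0 : R), t[%classic.
  by rewrite preimage_affine_itv ?invr_gt0 // subrr mul0r subr0 invrK mul1r.
have kerE s : 0 < s -> s < t ->
    (t - s) `^ (a - 1) * hyp2F1 (a + b) (- c) a (1 - s / t) =
    t `^ (a - 1) * K (s / t).
  move=> s0 st; rewrite /K series_kernel_hyp2F1 mulrA -powRM ?(ltW t0) //; last first.
    by rewrite subr_ge0 ler_pdivrMr // mul1r ltW.
  by rewrite mulrBr mulr1 [t * (_ / _)]mulrC divfK.
pose phi s := t `^ (a - 1) * K (t^-1 * s + 0) * g s.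
rewrite /saigo_pos.
have -> : \int[mu]_(s in `]0, t[) ((t - s) `^ (a - 1) *
    hyp2F1 (a + b) (- c) a (1 - s / t) * g s) = \int[mu]_(s in `]0, t[) phi s.
  apply: eq_Rintegral => s /set_mem /=; rewrite in_itv/= => /andP[s0 st].
  by rewrite kerE // /phi addr0 mulrC [t^-1 * s]mulrC mulrC.
have mphi : measurable_fun `]0, t[ phi.
  apply: measurable_funM; first apply: measurable_funM => //.
    rewrite -E2; apply: (@measurable_fun_affine R t^-1 0 `]0, 1[ K) => //.
    exact: gK.1.
  by apply: itv_oo_measurable_fun => s s0 _; exact: gg.1.
rewrite (@Rintegral_affine R t 0 `]0, t[ phi) // E1 (gtr0_norm t0).
have -> : \int[mu]_(x in `]0, 1[) phi (t * x + 0) =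
    t `^ (a - 1) * \int[mu]_(x in `]0, 1[) (K x * g (t * x)).
  rewrite -(Rintegral_scale _ _ iK) //; apply: eq_Rintegral => x _.
  by rewrite /phi !addr0 mulKf // -[LHS]mulrA.
rewrite /mellin_op mul0r add0r.
have -> : \int[mu]_(x in `]0, 1[) ((gamma_fun a)^-1 * K x * g (t * x)) =
    (gamma_fun a)^-1 * \int[mu]_(x in `]0, 1[) (K x * g (t * x)).
  rewrite -(Rintegral_scale _ _ iK) //; apply: eq_Rintegral => x _.
  by rewrite -[LHS]mulrA.
have -> : t `^ (- b) = t `^ (- a - b) * (t * t `^ (a - 1)).
  rewrite -powRS // subrK -powRD; first by congr (_ `^ _); ring.
  by apply/implyP.
by ring.
Qed.

(** Computed from the limit of n B(n+1, 1) = n / (n+1). *)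
Lemma gamma_fun1 (R : realType) : gamma_fun 1 = 1 :> R.
Proof.
have h1 := @beta_int_cvg_gamma R 1 0 ltr01 (ltW (ltrN10 R)).
have h2 : n.+1%:R `^ 1 * beta_int (n.+1%:R + 0) (1 - 1) @[n --> \oo] --> (1 : R).
  have h3 : 1 - n.+2%:R^-1 @[n --> \oo] --> (1 : R).
    rewrite -[X in _ --> X]subr0; apply: cvgB; first exact: cvg_cst.
    have := @cvg_harmonic R; rewrite -cvg_shiftS; exact.
  apply: cvg_trans h3; apply: near_eq_cvg; apply: nearW => n /=.
  have n0 : (0 : R) <= n.+1%:R by exact: ler0n.
  rewrite subrr beta_int0 ?addr0; last lra.
  rewrite powRr1 // natr1 -[in RHS](natr1 n.+1).
  have n2 : n.+1%:R + 1 != 0 :> R by rewrite natr1 pnatr_eq0.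
  rewrite natr1 in n2 *.
  rewrite -(natr1 n.+1) in n2 *.
  by move: (n.+1%:R : R) n2 => N N1; field.
exact: (cvg_unique _ h1 h2).
Qed.

(** Dividing by p - b + 1 is what integration does to t^(p-b): on powers, the
    operator of order one that occurs in the definition of order zero is a
    primitive of the order zero operator. *)
Lemma saigo_mult_primitive (R : realType) (b c p : R) :
  -1 < p -> b - c - 1 < p -> -1 < p - b ->
  saigo_mult 1 (b - 1) (c - 1) p = saigo_mult 0 b c p / (p - b + 1).
Proof.
move=> p1 p2 p3; rewrite /saigo_mult /beta_mult eqxx oner_eq0 subrr.
rewrite beta_int0 // gamma_fun1 divr1 mul1r add0r addr0.
have C0 : 0 < p + 1 by lra.
have D0 : 0 < p + 1 - b - (- c) by lra.
have := gauss_sum_contig C0 D0.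
rewrite (_ : 1 + (b - 1) = b); last by ring.
rewrite (_ : - (c - 1) = - c + 1); last by ring.
move=> h.
have n1 : p + 1 != 0 by lra.
have n2 : p - b + 1 != 0 by lra.
apply: (mulfI n1); rewrite mulrA divff // mul1r mulrA h.
by rewrite (_ : p + 1 - b = p - b + 1); [rewrite mulrAC divff // mul1r|ring].
Qed.

(** * Saigo operators of order zero *)

Lemma integrable_growth (R : realType) (e T : R) (g : R -> R) :
  -1 < e -> growth e g -> 0 < T -> mu.-integrable `]0, T[ (EFin \o g).
Proof.
move=> e1 [cg bg] T0; have [M M0 hM] := bg _ T0.
apply: (@dominated_integrable R _ _ (fun s => M * s `^ e)) => //.
- by apply: itv_oo_measurable_fun => s s0 _; exact: cg.
- by move=> s /=; rewrite in_itv/= => /andP[s0 sT]; apply: hM => //; exact: ltW.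
- by apply: integrable_scale => //; exact: integrable_powR.
Qed.

Lemma Rintegral_growth_bound (R : realType) (e T M : R) (g : R -> R) :
  -1 < e -> growth e g -> 0 < T ->
  (forall s, 0 < s -> s <= T -> `|g s| <= M * s `^ e) ->
  `|\int[mu]_(s in `]0, T[) g s| <= M * (T `^ (e + 1) / (e + 1)).
Proof.
move=> e1 gg T0 hM; have ig := integrable_growth e1 gg T0.
apply: (le_trans (le_normr_Rintegral _ ig)) => //.
rewrite -Rintegral_powR // -(Rintegral_scale _ _ (integrable_powR e1 T0)) //.
apply: le_Rintegral => //.
- exact: integrable_norm ig.
- by apply: integrable_scale => //; exact: integrable_powR.
- by move=> s /=; rewrite in_itv/= => /andP[s0 sT]; apply: hM => //; exact: ltW.
Qed.

Lemma Rintegral_power_sum (R : realType) (e T : R) (c : R^nat) (n : nat) :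
  -1 < e -> 0 < T ->
  \int[mu]_(s in `]0, T[) power_sum e c n s =
  power_sum (e + 1) (fun i => c i / (e + i%:R + 1)) n T.
Proof.
move=> e1 T0; elim: n => [|n ih].
  rewrite /power_sum big_ord0 (_ : (fun s : R => _) = (fun=> 0)); last first.
    by apply/funext => s; rewrite big_ord0.
  by rewrite /Rintegral integral0.
have en : -1 < e + n%:R by rewrite ltr_wpDr.
have i1 := integrable_growth e1 (growth_power_sum e c n) T0.
have i2 := integrable_powR en T0.
transitivity (\int[mu]_(s in `]0, T[) (power_sum e c n s + c n * s `^ (e + n%:R))).
  by apply: eq_Rintegral => s _; rewrite /power_sum big_ord_recr.
rewrite RintegralD //; last exact: integrable_scale.
rewrite ih (Rintegral_scale _ _ i2) // Rintegral_powR // [RHS]/power_sum big_ord_recr /=.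
congr (_ + _); rewrite (_ : e + 1 + n%:R = e + n%:R + 1); last by ring.
by rewrite mulrA mulrAC.
Qed.

Lemma saigo_mult0 (R : realType) (b c p : R) : -1 < p -> b - c - 1 < p ->
  1 + moment (saigo_kernel 0 b c) p = saigo_mult 0 b c p.
Proof.
move=> p1 p2; have [_ <-] := saigo_kernel_moment (lexx 0) p1 p2.
by rewrite /saigo_atom eqxx.
Qed.

(** Both sides are continuous in the weighted sup norm and agree on power sums, by
    the relation between the two multipliers; density concludes. *)
Lemma saigo_primitive (R : realType) (b c e e' t : R) (g : R -> R) :
  -1 < e -> b - c - 1 < e -> -1 < e - b -> e < e' -> growth e' g -> 0 < t ->
  saigo_pos 1 (b - 1) (c - 1) g t =
  \int[mu]_(s in `]0, t[) mellin_op 1 (saigo_kernel 0 b c) (- b) g s.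
Proof.
move=> e1 e2 e3 ee gg' t0.
have gg : growth e g by apply: growth_weaken gg'; exact: ltW.
have e2' : (b - 1) - (c - 1) - 1 < e by lra.
have [gk1 _] := saigo_kernel_moment ler01 e1 e2'.
have [gk0 _] := saigo_kernel_moment (lexx 0) e1 e2.
pose k1 : R -> R := saigo_kernel 1 (b - 1) (c - 1).
pose k0 : R -> R := saigo_kernel 0 b c.
rewrite (saigo_pos_mellin ltr01 e1 e2' gg t0).
pose C1 : R := (`|0 : R| + abs_moment k1 e) * t `^ (e + - (b - 1)).
pose C0 : R := (`|1 : R| + abs_moment k0 e) * (t `^ (e - b + 1) / (e - b + 1)).
have C1ge : 0 <= C1 by rewrite mulr_ge0 ?powR_ge0 // addr_ge0 // abs_moment_ge0.
have C0ge : 0 <= C0.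
  apply: mulr_ge0; first by rewrite addr_ge0 // abs_moment_ge0.
  by rewrite divr_ge0 ?powR_ge0 //; lra.
apply: (@growth_density R (fun h => mellin_op 0 k1 (- (b - 1)) h t)
  (fun h => \int[mu]_(s in `]0, t[) mellin_op 1 k0 (- b) h s) g e e' t (C1 + C0)) => //.
- exact: addr_ge0.
- move=> c' n; rewrite mellin_op_power_sum //.
  transitivity (\int[mu]_(s in `]0, t[)
      power_sum (e - b) (fun i => c' i * (1 + moment k0 (e + i%:R))) n s); last first.
    apply: eq_Rintegral => s /set_mem /=; rewrite in_itv/= => /andP[s0 _].
    by rewrite mellin_op_power_sum.
  rewrite Rintegral_power_sum // (_ : e + - (b - 1) = e - b + 1); last by ring.
  rewrite /power_sum; apply: eq_bigr => i _; congr (_ * _).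
  have i0 : (0 : R) <= i%:R by exact: ler0n.
  have p1 : -1 < e + i%:R by lra.
  have p2 : b - c - 1 < e + i%:R by lra.
  have p3 : -1 < e + i%:R - b by lra.
  have p2' : (b - 1) - (c - 1) - 1 < e + i%:R by lra.
  have [_ h1] := saigo_kernel_moment ler01 p1 p2'.
  rewrite /saigo_atom oner_eq0 in h1; rewrite /k1 h1 saigo_mult_primitive //.
  by rewrite /k0 saigo_mult0 // mulrA; congr (_ / _); ring.
- move=> f delta gf d0 h.
  have bnd s : 0 < s -> s <= t -> `|mellin_op 1 k0 (- b) g s - mellin_op 1 k0 (- b) f s| <=
      delta * (`|1 : R| + abs_moment k0 e) * s `^ (e - b).
    move=> s0 st; apply: mellin_op_lipschitz => // u u0 us; apply: h => //.
    exact: le_trans us st.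
  have g1 : growth (e - b) (mellin_op 1 k0 (- b) g) by exact: mellin_op_growth.
  have g2 : growth (e - b) (mellin_op 1 k0 (- b) f) by exact: mellin_op_growth.
  split.
    have := mellin_op_lipschitz 0 (- (b - 1)) gk1 gg gf t0 h.
    move=> /le_trans; apply; rewrite mulrDl -mulrA -/k1 -/C1 [C1 * _]mulrC.
    by rewrite lerDl mulr_ge0 // ltW.
  have i1 := integrable_growth e3 g1 t0; have i2 := integrable_growth e3 g2 t0.
  rewrite -RintegralB //.
  have := Rintegral_growth_bound e3 (growthB g1 g2) t0 bnd.
  move=> /le_trans; apply; rewrite mulrDl -mulrA -/C0 [C0 * _]mulrC.
  by rewrite lerDr mulr_ge0 // ltW.
Qed.

(** The order zero operator is defined as a derivative; as the function it
    differentiates is the integral of a continuous function, the derivative is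
    that function. *)
Lemma saigo_order0_mellin (R : realType) (b c e e' t : R) (g : R -> R) :
  -1 < e -> b - c - 1 < e -> -1 < e - b -> e < e' -> growth e' g -> 0 < t ->
  derive1 (saigo_pos 1 (b - 1) (c - 1) g) t =
  mellin_op 1 (saigo_kernel 0 b c) (- b) g t.
Proof.
move=> e1 e2 e3 ee gg' t0.
have gg : growth e g by apply: growth_weaken gg'; exact: ltW.
have [gk0 _] := saigo_kernel_moment (lexx 0) e1 e2.
set Tg := mellin_op 1 (saigo_kernel 0 b c) (- b) g.
have gT : growth (e - b) Tg by exact: mellin_op_growth.
have t1 : t < t + 1 by lra.
have T10 : 0 < t + 1 + 1 by lra.
have iT : mu.-integrable `]0, (t + 1)] (EFin \o Tg).
  apply: integrableS (integrable_growth e3 gT T10) => //.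
  by move=> x /=; rewrite !in_itv/= => /andP[? ?]; apply/andP; split; lra.
have ax : (BRight 0 < BRight t)%O by rewrite bnd_simp.
have [dF EF] := continuous_FTC1 t1 iT ax (gT.1 t t0).
(* FTC1 differentiates the integral over ]0, x], which agrees with the one over
   ]0, x[ near t. *)
rewrite -EF derive1E [RHS]derive1E.
apply: near_eq_derive.
near=> x.
have x0 : 0 < x by near: x; exact: lt_nbhsr.
rewrite (saigo_primitive e1 e2 e3 ee gg' x0) Rintegral_itv_bndo_bndc //.
apply: (integrable_growth e3 gT x0).
Unshelve. all: by end_near. Qed.

Lemma saigo_mellin (R : realType) (a b c e e' t : R) (g : R -> R) :
  0 <= a -> -1 < e -> b - c - 1 < e -> -1 < e - b -> e < e' -> growth e' g ->
  0 < t ->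
  saigo a b c g t = mellin_op (saigo_atom a) (saigo_kernel a b c) (- b) g t.
Proof.
move=> a0 e1 e2 e3 ee gg t0; rewrite /saigo /saigo_atom.
case: eqVneq => [->|an0]; first exact: saigo_order0_mellin ee gg t0.
apply: saigo_pos_mellin e1 e2 _ t0; first by rewrite lt_neqAle eq_sym an0.
by apply: growth_weaken gg; exact: ltW.
Qed.

(** * Composition of the two Saigo operators *)

Lemma eq_growth (R : realType) (e : R) (f g : R -> R) :
  (forall s, 0 < s -> f s = g s) -> growth e f -> growth e g.
Proof.
move=> fg [cf bf]; split.
  move=> t t0; rewrite /prop_for /continuous_at -fg //.
  apply: cvg_trans (cf t t0); apply: near_eq_cvg; near=> s.
  by apply: fg; near: s; exact: lt_nbhsr.
move=> T T0; have [M M0 hM] := bf _ T0; exists M => // s s0 sT.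
by rewrite -fg // hM.
Unshelve. all: by end_near. Qed.

Lemma rl_kernelE (R : realType) (n : nat) (e t : R) (g : R -> R) :
  -1 < e -> growth e g -> 0 < t ->
  mellin_op 0 (@rl_kernel R n) n.+1%:R g t =
  \int[mu]_(s in `]0, t[) ((t - s) ^+ n / n`!%:R * g s).
Proof.
move=> e1 gg t0; have tn0 : t != 0 by rewrite gt_eqF.
have [gk _] := rl_kernel_moment n e1.
have ik := integrable_mellin gk gg t0.
have E1 : (fun x : R => t * x + 0) @^-1` `]0, t[ = `](0 : R), 1[%classic.
  by rewrite preimage_affine_itv // subrr mul0r subr0 divff.
have mphi : measurable_fun `]0, t[ (fun s => (t - s) ^+ n / n`!%:R * g s).
  apply: measurable_funM; last by apply: itv_oo_measurable_fun => s s0 _; exact: gg.1.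
  by apply: measurable_funM => //; apply: measurable_funX; exact: measurable_funB.
rewrite (@Rintegral_affine R t 0 `]0, t[) // E1 (gtr0_norm t0).
have -> : \int[mu]_(x in `]0, 1[) ((t - (t * x + 0)) ^+ n / n`!%:R * g (t * x + 0)) =
    t ^+ n * \int[mu]_(x in `]0, 1[) (rl_kernel n x * g (t * x)).
  rewrite -(Rintegral_scale _ _ ik) //; apply: eq_Rintegral => x /set_mem /=.
  rewrite in_itv/= => /andP[x0 x1].
  rewrite addr0 /rl_kernel powR_mulrn ?subr_ge0 ?(ltW x1) //.
  by rewrite -[X in (X - _) ^+ n](mulr1 t) -mulrBr exprMn; ring.
rewrite /mellin_op mul0r add0r mulrA -exprS powR_mulrn //; exact: ltW.
Qed.

Lemma saigo_moment_compose (R : realType) (alpha beta gamma p : R) (n : nat) :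
  0 < alpha -> alpha <= n.+1%:R ->
  Num.max 0 (- beta - n.+1%:R - alpha - gamma) - 1 < p ->
  Num.max 0 (beta - gamma) - 1 < p + beta + n.+1%:R ->
  (saigo_atom (n.+1%:R - alpha) +
    moment (saigo_kernel (n.+1%:R - alpha) (- beta - n.+1%:R) (alpha + gamma)) p) *
  (saigo_atom alpha +
    moment (saigo_kernel alpha beta gamma) (p + beta + n.+1%:R)) =
  moment (@rl_kernel R n) p.
Proof.
move=> a0 am h1 h2.
move: (h1) (h2); rewrite !ltrBlDr !gt_max => /andP[p1 p2] /andP[q1 q2].
have p1' : -1 < p by lra.
have p2' : - beta - n.+1%:R - (alpha + gamma) - 1 < p by lra.
have q1' : -1 < p + beta + n.+1%:R by lra.
have q2' : beta - gamma - 1 < p + beta + n.+1%:R by lra.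
have am0 : 0 <= n.+1%:R - alpha by rewrite subr_ge0.
have [_ ->] := saigo_kernel_moment am0 p1' p2'.
have [_ ->] := saigo_kernel_moment (ltW a0) q1' q2'.
have [_ ->] := rl_kernel_moment n p1'.
by rewrite mulrC saigo_mult_compose.
Qed.

(** Both sides are Mellin type operators applied to g, so by density they need only
    be compared on powers t^p with p >= e, where they multiply by the same
    factor. *)
Lemma saigo_compose (R : realType) (alpha beta gamma eps t : R) (n : nat) (g : R -> R) :
  0 < alpha -> alpha <= n.+1%:R ->
  Num.max 0 (- beta - n.+1%:R - alpha - gamma) - 1 < eps ->
  Num.max 0 (beta - gamma) - 1 < eps + beta + n.+1%:R ->
  growth eps g -> 0 < t ->
  saigo alpha beta gamma
    (saigo (n.+1%:R - alpha) (- beta - n.+1%:R) (alpha + gamma) g) t =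
  \int[mu]_(s in `]0, t[) ((t - s) ^+ n / n`!%:R * g s).
Proof.
set m : R := n.+1%:R; move=> a0 am h1 h2 gg t0.
have m0 : 0 <= m by exact: ler0n.
move: (h1) (h2); rewrite !ltrBlDr !gt_max => /andP[h11 h12] /andP[h21 h22].
(* The conditions on eps are open, so some e < eps satisfies them too; the gap
   is what makes power sums dense. *)
pose e := (eps + Num.max (Num.max 0 (- beta - m - alpha - gamma) - 1)
  (Num.max 0 (beta - gamma) - 1 - beta - m)) / 2.
have elt : e < eps.
  have : Num.max (Num.max 0 (- beta - m - alpha - gamma) - 1)
      (Num.max 0 (beta - gamma) - 1 - beta - m) < eps.
    by rewrite gt_max; apply/andP; split; lra.
  rewrite /e; lra.
have he : Num.max (Num.max 0 (- beta - m - alpha - gamma) - 1)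
      (Num.max 0 (beta - gamma) - 1 - beta - m) < e.
  by rewrite /e; move: elt; rewrite /e; lra.
move: he; rewrite gt_max => /andP[he1 he2'].
have he2 : Num.max 0 (beta - gamma) - 1 < e + beta + m by lra.
move: (he1) (he2); rewrite !ltrBlDr !gt_max => /andP[e11 e12] /andP[e21 e22].
pose d2 := - (- beta - m).
pose h := saigo (m - alpha) (- beta - m) (alpha + gamma) g.
have am0 : 0 <= m - alpha by lra.
pose k1 := saigo_kernel alpha beta gamma.
pose k2 := saigo_kernel (m - alpha) (- beta - m) (alpha + gamma).
pose c1 : R := saigo_atom alpha.
pose c2 : R := saigo_atom (m - alpha).
have hE s : 0 < s -> mellin_op c2 k2 d2 g s = h s.
  by move=> s0; rewrite /h (saigo_mellin (e := e) (e' := eps)) //; lra.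
have gk2' p : 0 < p + 1 -> - beta - m - alpha - gamma < p + 1 -> good_kernel k2 p.
  move=> p1 p2; have q1 : -1 < p by lra.
  have q2 : - beta - m - (alpha + gamma) - 1 < p by lra.
  by have [] := saigo_kernel_moment am0 q1 q2.
have gk2e := gk2' _ h11 h12.
have gk2 := gk2' _ e11 e12.
have gk1 : good_kernel k1 (e + d2).
  have q1 : -1 < e + d2 by rewrite /d2; lra.
  have q2 : beta - gamma - 1 < e + d2 by rewrite /d2; lra.
  by have [] := saigo_kernel_moment (ltW a0) q1 q2.
have gh : growth (eps + d2) h by apply: eq_growth hE _; exact: mellin_op_growth.
rewrite (saigo_mellin (e := e + d2) (e' := eps + d2)) //; try (rewrite /d2; lra).
rewrite -(@eq_mellin_op R _ _ (mellin_op c2 k2 d2 g)) //; last by move=> s s0 _; exact: hE.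
rewrite -(@rl_kernelE R n eps) //; last lra.
have gge : growth e g by apply: growth_weaken gg; exact: ltW.
have [gkr _] := @rl_kernel_moment R n e ltac:(lra).
have Ee : e + d2 + - beta = e + m by rewrite /d2; ring.
pose C1 : R := (`|c2| + abs_moment k2 e) * 
  ((`|c1| + abs_moment k1 (e + d2)) * t `^ (e + d2 + - beta)).
pose C2 : R := (`|0 : R| + abs_moment (@rl_kernel R n) e) * t `^ (e + m).
have C1ge : 0 <= C1 by rewrite !mulr_ge0 ?powR_ge0 // addr_ge0 // abs_moment_ge0.
have C2ge : 0 <= C2 by rewrite !mulr_ge0 ?powR_ge0 // addr_ge0 // abs_moment_ge0.
apply: (@growth_density R
  (fun f => mellin_op c1 k1 (- beta) (mellin_op c2 k2 d2 f) t)
  (fun f => mellin_op 0 (@rl_kernel R n) m f t) g e eps t (C1 + C2)) => //.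
- exact: addr_ge0.
- move=> c j; rewrite (mellin_op_power_sum 0 m c j gkr t0).
  rewrite (eq_mellin_op c1 k1 (- beta) t0
    (fun s s0 _ => mellin_op_power_sum c2 d2 c j gk2 s0)).
  rewrite (mellin_op_power_sum c1 (- beta) _ j gk1 t0) Ee.
  have prod (i : nat) : (c2 + moment k2 (e + i%:R)) *
      (c1 + moment k1 (e + d2 + i%:R)) = moment (@rl_kernel R n) (e + i%:R).
    have i0 : (0 : R) <= i%:R by exact: ler0n.
    have -> : e + d2 + i%:R = e + i%:R + beta + m by rewrite /d2; ring.
    by apply: saigo_moment_compose => //; rewrite -/m; lra.
  apply: eq_bigr => i _.
  by rewrite -(mulrA (c i)) prod (add0r (moment _ _)).
- move=> f delta gf d0 hf.
  split.
    have bnd s : 0 < s -> s <= t -> `|mellin_op c2 k2 d2 g s - mellin_op c2 k2 d2 f s| <=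
        delta * (`|c2| + abs_moment k2 e) * s `^ (e + d2).
      move=> s0 st; apply: mellin_op_lipschitz => // u u0 us; apply: hf => //.
      exact: le_trans us st.
    have g1 := mellin_op_growth c2 d2 gk2 gge.
    have g2 := mellin_op_growth c2 d2 gk2 gf.
    apply: (le_trans (mellin_op_lipschitz c1 (- beta) gk1 g1 g2 t0 bnd)).
    rewrite -2!mulrA -/C1 [delta * _]mulrC ler_wpM2r ?(ltW d0) //.
    by rewrite lerDl.
  apply: (le_trans (mellin_op_lipschitz 0 m gkr gge gf t0 hf)).
  rewrite -mulrA -/C2 [delta * _]mulrC ler_wpM2r ?(ltW d0) //.
  by rewrite lerDr.
Qed.

(** * Taylor's formula with integral remainder *)

Lemma diff_quot_cvg (R : realType) (F : R -> R) (x : R) : derivable F x 1 ->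
  diff_quot F x @ x^' --> F^`()%classic x.
Proof.
move=> dF.
have h : h^-1 * (F (h + x) - F x) @[h --> (0 : R)^'] --> F^`()%classic x.
  move: dF; rewrite /derivable.
  have -> : (fun h : R => h^-1 *: ((F \o shift x) (h *: 1) - F x)) =
      (fun h => h^-1 * (F (h + x) - F x)).
    by apply/funext => h; rewrite /= [h *: 1]mulr1.
  exact.
apply/cvgrPdist_le => e e0.
have /cvgrPdist_le /(_ _ e0) [r /= r0 hr] := h.
exists r => //= y; rewrite /ball_ /= => xy yx.
have := hr (y - x); rewrite /ball_ /= sub0r normrN distrC => /(_ xy).
by rewrite subr_eq0 => /(_ yx); rewrite subrK /diff_quot mulrC.
Qed.

Lemma within_dnbhs_interior (R : realType) (A : set R) (x : R) :
  nbhs x A -> within A x^' = x^'.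
Proof.
move=> nA; apply/seteqP; split => B hB.
  have nA' : x^' A by apply: filterS nA.
  by apply: filterS2 nA' hB => y Ay; exact.
by apply: filterS hB => y.
Qed.

Lemma derive1_within_interior (R : realType) (F G : R -> R) (x : R) :
  0 < x -> derivable F x 1 -> (forall y, 0 < y -> G y = F y) ->
  derive1_within `[0, +oo[ G x = derive1 F x.
Proof.
move=> x0 dF GF; rewrite /derive1_within within_dnbhs_interior; last first.
  by near=> y; rewrite /= in_itv/= andbT ltW //; near: y; exact: lt_nbhsr.
apply: cvg_lim => //; apply: cvg_trans (diff_quot_cvg dF); apply: near_eq_cvg.
apply: cvg_within; near=> y; rewrite /diff_quot !GF //.
by near: y; exact: lt_nbhsr.
Unshelve. all: by end_near. Qed.

(** One-sided differentiability at 0 gives right-continuity there, which is the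
    boundary condition of the fundamental theorem of calculus on ]0, t[. *)
Lemma derivable_within_cvg0 (R : realType) (G : R -> R) :
  derivable_within `[0, +oo[ G 0 -> G y @[y --> 0^'+] --> G 0.
Proof.
move=> dG.
have h1 : diff_quot G 0 y @[y --> 0^'+] --> derive1_within `[0, +oo[ G 0.
  apply: cvg_trans dG; apply: cvg_app => B [r /= r0 hr].
  exists r => //= y; rewrite /ball_ /= => yr y0.
  by apply: hr => //=; [rewrite gt_eqF|rewrite in_itv/= andbT ltW].
have h2 : diff_quot G 0 y * y + G 0 @[y --> 0^'+] --> G 0.
  rewrite -[X in _ --> X]add0r -[X in X + _](mulr0 (derive1_within `[0, +oo[ G 0)).
  apply: cvgD; last exact: cvg_cst.
  by apply: cvgM => //; apply: cvg_at_right_filter; exact: cvg_id.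
apply: cvg_trans h2; apply: near_eq_cvg; near=> y.
have y0 : y != 0 by rewrite gt_eqF //; near: y; exact: nbhs_right_gt.
by rewrite /diff_quot subr0 divfK // subrK.
Unshelve. all: by end_near. Qed.

Lemma derive1n_withinE (R : realType) (f : R -> R) (m k : nat) (x : R) :
  cont_diff_pos m f -> (k <= m)%N -> 0 < x ->
  derive1n_within `[0, +oo[ k f x = derive1n k f x.
Proof.
move=> [df _]; elim: k x => // k ih x km x0.
apply: derive1_within_interior => //; first exact: df.
by move=> y y0; apply: ih => //; exact: ltnW.
Qed.

(** Differentiating the sum in the base point u telescopes. *)
Lemma taylor_sum_derive (R : realType) (F : nat -> R -> R) (t s : R) (n : nat) :
  (forall k, (k <= n)%N -> is_derive s 1 (F k) (F k.+1 s)) ->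
  is_derive s 1 (fun u => \sum_(k < n.+1) F k u * ((t - u) ^+ k / k`!%:R))
    (F n.+1 s * ((t - s) ^+ n / n`!%:R)).
Proof.
have dlin k : is_derive s 1 (fun u : R => (t - u) ^+ k / k`!%:R)
    (- (k%:R * (t - s) ^+ k.-1 / k`!%:R)).
  have d1 : is_derive s 1 (fun u : R => t - u) (-1).
    have h := is_deriveB (is_derive_cst t s 1) (is_derive_id s 1).
    by apply: is_derive1_eq h _ _ => //; rewrite sub0r.
  have d2 := is_deriveM (is_deriveX k d1) (is_derive_cst (k`!%:R^-1 : R) s 1).
  apply: is_derive1_eq d2 _ _.
    by move=> u; rewrite !fctE.
  by rewrite !fctE /GRing.scale /= mulr0 add0r; ring.
elim: n => [|n ih] dF.
  have := dF 0%N isT; have -> : (fun u => \sum_(k < 1) F k u * ((t - u) ^+ k / k`!%:R)) = F 0%N.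
    by apply/funext => u; rewrite big_ord_recl big_ord0 /= expr0 fact0 divr1 mulr1 addr0.
  by rewrite expr0 fact0 divr1 mulr1.
have {}ih := ih (fun k kn => dF k (leqW kn)).
have dM := is_deriveM (dF n.+1 (leqnn _)) (dlin n.+1).
have h := is_deriveD ih dM.
apply: is_derive1_eq h _ _.
  by move=> u; rewrite [RHS]big_ord_recr.
rewrite /GRing.scale /= factS natrM.
have f0 : n`!%:R != 0 :> R by rewrite pnatr_eq0 -lt0n fact_gt0.
have n0 : n.+1%:R != 0 :> R by rewrite pnatr_eq0.
move: (n.+1%:R : R) (n`!%:R : R) n0 f0 => N f n0 f0.
by field; rewrite n0 f0.
Qed.

(** The Taylor sum based at u equals f t at u = t and the Taylor polynomial at
    u = 0, and the integrand is its derivative in u. The growth bound makes the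
    integrand integrable although the last derivative may be unbounded at 0. *)
Lemma taylor_remainder (R : realType) (f : R -> R) (n : nat) (e t : R) :
  cont_diff_within `[0, +oo[ n f -> cont_diff_pos n.+1 f ->
  -1 < e -> growth e (derive1n n.+1 f) -> 0 < t ->
  \int[mu]_(s in `]0, t[) ((t - s) ^+ n / n`!%:R * derive1n n.+1 f s) =
  f t - \sum_(k < n.+1) (derive1n_within `[0, +oo[ k f 0 / k`!%:R * t ^+ k).
Proof.
move=> [dw cw] cp e1 gg t0; have [dp cpp] := cp.
pose F k := derive1n_within `[0, +oo[ k f.
have FE k (x : R) : (k <= n.+1)%N -> 0 < x -> F k x = derive1n k f x.
  by move=> km x0; exact: derive1n_withinE cp km x0.
have dF k (x : R) : (k <= n)%N -> 0 < x -> is_derive x 1 (F k) (F k.+1 x).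
  move=> kn x0; apply: (@near_eq_is_derive _ _ _ (derive1n k f)).
    near=> y; rewrite FE //; first exact: leqW.
    by near: y; exact: lt_nbhsr.
  rewrite FE // derive1nS derive1E; apply: derivableP.
  exact: dp.
have F0 k : (k <= n)%N -> F k y @[y --> 0^'+] --> F k 0.
  rewrite leq_eqVlt => /orP[/eqP ->|kn].
    by have /continuous_within_itvcyP[_] := cw.
  by apply: derivable_within_cvg0; apply: dw => //=; rewrite in_itv/= lexx.
pose phi (u : R) := \sum_(k < n.+1) F k u * ((t - u) ^+ k / k`!%:R).
pose psi (s : R) := (t - s) ^+ n / n`!%:R * derive1n n.+1 f s.
have cpow k (x : R) : {for x, continuous (fun u : R => (t - u) ^+ k / k`!%:R)}.
  apply: cvgMl; apply: (@cvg_comp _ _ _ (fun u : R => t - u) (fun z => z ^+ k)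
    (nbhs x) (nbhs (t - x))).
    by apply: cvgB; [exact: cvg_cst|exact: cvg_id].
  exact: exprn_continuous.
have dphi (x : R) : 0 < x -> is_derive x 1 phi (psi x).
  move=> x0; rewrite /psi mulrC -FE //.
  by apply: taylor_sum_derive => k kn; exact: dF.
have cpsi (x : R) : 0 < x -> x < t -> {for x, continuous psi}.
  by move=> x0 _; apply: cvgM; [exact: cpow|exact: cpp].
have phi0 : phi x @[x --> 0^'+] --> phi 0.
  suff : forall N, (N <= n.+1)%N ->
      \sum_(k < N) F k u * ((t - u) ^+ k / k`!%:R) @[u --> 0^'+] -->
      \sum_(k < N) F k 0 * ((t - 0) ^+ k / k`!%:R) by apply.
  elim=> [|N ih] Nn.
    by under eq_fun do rewrite big_ord0; rewrite big_ord0; exact: cvg_cst.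
  under eq_fun do rewrite big_ord_recr; rewrite big_ord_recr /=.
  apply: cvgD; first by apply: ih; exact: ltnW.
  apply: cvgM; first exact: F0.
  by apply: cvg_at_right_filter; exact: cpow.
have phit : phi x @[x --> t^'-] --> phi t.
  by apply: cvg_at_left_filter; exact: is_derive1_continuous (dphi t t0).
have ipsi : mu.-integrable `]0, t[ (EFin \o psi).
  have ig := integrable_growth e1 gg t0.
  apply: (@dominated_integrable R _ _ (fun s => (t ^+ n / n`!%:R) * `|derive1n n.+1 f s|)) => //.
  - exact: itv_oo_measurable_fun.
  - move=> x /=; rewrite in_itv/= => /andP[x0 xt].
    rewrite normrM ler_wpM2r // ger0_norm; last first.
      by rewrite divr_ge0 // exprn_ge0 // subr_ge0 ltW.
    rewrite ler_wpM2r ?invr_ge0 // lerXn2r ?nnegrE ?subr_ge0 ?(ltW t0) ?(ltW xt) //.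
    by rewrite lerBlDr lerDl ltW.
  - by apply: integrable_scale => //; exact: integrable_norm ig.
have dphi' x (x0 : 0 < x) (_ : x < t) := dphi x x0.
rewrite (Rintegral_FTC_oo t0 cpsi dphi' phi0 phit ipsi); congr (_ - _).
  rewrite /phi big_ord_recl /= expr0 fact0 divr1 mulr1 big1 ?addr0 //.
  by move=> k _; rewrite subrr exprS mul0r mul0r mulr0.
by rewrite /phi; apply: eq_bigr => k _; rewrite subr0 mulrA mulrAC.
Unshelve. all: by end_near. Qed.

Lemma growth_of_bigO (R : realType) (e : R) (g : R -> R) :
  (forall t, 0 < t -> {for t, continuous g}) ->
  g =O_ (0^'+) (fun t : R => t `^ e) -> growth e g.
Proof.
move=> cg /eqO_exP[M M0 [r /= r0 hr]]; split => // T T0.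
have near0 s : 0 < s -> s < r -> `|g s| <= M * s `^ e.
  move=> s0 sr; have := hr s; rewrite /ball_ /= sub0r normrN gtr0_norm //.
  by move=> /(_ sr s0); rewrite (ger0_norm (powR_ge0 _ _)).
(* On ]0, rho[ the asymptotic bound applies, on [rho, T] compactness. *)
pose rho := Num.min (r / 2) T.
have rho0 : 0 < rho by rewrite lt_min T0 andbT; lra.
have rhoT : rho <= T by rewrite ge_min lexx orbT.
have rhor : rho < r by rewrite gt_min; apply/orP; left; lra.
have cq : {within `[rho, T], continuous (fun s => `|g s| * s `^ (- e))}.
  apply: continuous_in_subspaceT => s /set_mem /=; rewrite in_itv/= => /andP[s1 _].
  have s0 : 0 < s by lra.
  apply: cvgM; last exact: powR_continuous.
  by apply: cvg_norm; exact: cg.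
have [c _ hc] := EVT_max rhoT cq.
exists (M + `|g c| * c `^ (- e)); first by rewrite addr_ge0 ?mulr_ge0 ?powR_ge0 // ltW.
move=> s s0 sT; rewrite mulrDl.
have [sr|sr] := ltP s rho.
  apply: (le_trans (near0 _ s0 (lt_trans sr rhor))).
  by rewrite lerDl !mulr_ge0 ?powR_ge0.
have := hc s; rewrite in_itv/= sr sT => /(_ isT) h.
have E : s `^ (- e) * s `^ e = 1 by rewrite powRN mulVf // gt_eqF // powR_gt0.
have := ler_wpM2r (powR_ge0 s e) h; rewrite -mulrA E mulr1 => /le_trans; apply.
by rewrite lerDr mulr_ge0 ?powR_ge0 // ltW.
Qed.

(** * The composition formula *)

Theorem theorem4p1 (R : realType) (alpha beta gamma : R) (m : nat)
  (f : R -> R) (eps : R)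
  (alpha_gt0 : 0 < alpha)
  (m_lt : m%:R - 1 < alpha) (m_ge : alpha <= m%:R)
  (f_C0 : cont_diff_within `[0, +oo[ m.-1 f)
  (f_Cpos : cont_diff_pos m f)
  (f_bigO : derive1n m f =O_ (0^'+) (fun t : R => t `^ eps))
  (eps_inner : Num.max 0 (- beta - m%:R - alpha - gamma) - 1 < eps)
  (eps_outer : Num.max 0 (beta - gamma) - 1 < eps + beta + m%:R) :
  forall t : R, 0 < t ->
    saigo alpha beta gamma (saigo_caputo m alpha beta gamma f) t =
    f t - \sum_(k < m) (derive1n_within `[0, +oo[ k f 0 / k`!%:R * t ^+ k).
Proof.
case: m m_lt m_ge f_C0 f_Cpos f_bigO eps_inner eps_outer => [|n].
  by move=> _ /(lt_le_trans alpha_gt0); rewrite ltxx.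
move=> _ am fC0 fCpos fO e1 e2 t t0.
have gg : growth eps (derive1n n.+1 f) by apply: growth_of_bigO => //; exact: fCpos.2.
have eps1 : -1 < eps by move: e1; rewrite ltrBlDr gt_max => /andP[? _]; lra.
rewrite -(taylor_remainder fC0 fCpos eps1 gg t0).
exact: (saigo_compose alpha_gt0 am e1 e2 gg t0).
Qed.
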